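(* Let $p,q$ be positive integers and let $r=p/q\in\mathbb Q_{>2}$. The following are equivalent: (i) $E_r^{\mathrm c}$ and $E_r^{\mathrm o}$ are asymptotically equivalent. (ii) There is a sequence of natural numbers $m_n=n+o(n)$ such that for every $n\in\mathbb N$ there is a rational number $a_n/b_n<p/q$ with $E_{p/q}^{\boxtimes n}\le E_{a_n/b_n}^{\boxtimes m_n}$. (iii) For every $\varepsilon>0$ there is a $\delta>0$ such that for any $a/b\in\mathbb Q_{\ge2}$, if $0<p/q-a/b<\delta$, then for every $F\in\mathcal X$, $F(E_{p/q})-F(E_{a/b})<\varepsilon$. (iv) For every sequence of rational numbers $a_n/b_n$, if $a_n/b_n\to p/q$ from below (that is, $a_n/b_n\le p/q$ for all $n$ and $a_n/b_n\to p/q$), then $E_{a_n/b_n}$ converges to $E_{p/q}$ in the asymptotic spectrum distance. (v) For every $F\in\mathcal X$, $\sup_{a/b<p/q}F(E_{a/b})=F(E_{p/q})$.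
   Context: Graphs are simple and may be infinite. $E_n$ denotes the graph with $n$ vertices and no edges, $G\sqcup H$ the disjoint union, and $G\boxtimes H$ the strong product: its vertex set is $V(G)\times V(H)$, and distinct $(a,x),(b,y)$ are adjacent iff ($a=b$ or $\{a,b\}\in E(G)$) and ($x=y$ or $\{x,y\}\in E(H)$). A cohomomorphism $G\to H$ is a map $f:V(G)\to V(H)$ such that for all distinct non-adjacent $u,v\in V(G)$ the vertices $f(u),f(v)$ are distinct and non-adjacent in $H$. Write $G\le H$ if there is a cohomomorphism $G\to H$. Write $G\lesssim H$ if there is $f:\mathbb N\to\mathbb N$ with $f(n)=o(n)$ such that $G^{\boxtimes n}\le H^{\boxtimes(n+f(n))}$ for all $n\in\mathbb N$; $G,H$ are asymptotically equivalent if $G\lesssim H$ and $H\lesssim G$. The asymptotic spectrum of graphs $\mathcal X$ is the set of all maps $F$ from finite graphs to $\mathbb R_{\ge 0}$ with $F(G\sqcup H)=F(G)+F(H)$, $F(G\boxtimes H)=F(G)F(H)$, $F(E_n)=n$ for all $n\in\mathbb N$, and $G\le H\Rightarrow F(G)\le F(H)$. The asymptotic spectrum distance of finite graphs is $d(G,H)=\sup_{F\in\mathcal X}|F(G)-F(H)|$, and $G_i$ converges to $H$ if $d(G_i,H)\to 0$. Fractions are written with positive integer numerator and denominator. For positive integers $p,q$ with $p/q\ge 2$, the fraction graph $E_{p/q}$ has vertex set $\{0,\dots,p-1\}$, and distinct $u,v$ are adjacent iff $u-v \bmod p<q$ or $v-u\bmod p<q$. By convention, if $p/q<2$ then $E_{p/q}$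 is the complete graph on $p$ vertices. If $p/q=p'/q'$ as rational numbers then $E_{p/q}\le E_{p'/q'}\le E_{p/q}$. Let $C$ be a circle of unit circumference, with distance measured along the circle. For $r\in\mathbb R_{\ge2}$, $E_r^{\mathrm o}$ (resp. $E_r^{\mathrm c}$) is the graph with vertex set $C$ in which two distinct vertices are adjacent iff their distance on $C$ is strictly less than $1/r$ (resp. at most $1/r$). *)

(* Defs.v *)
From HB Require Import structures.
From mathcomp Require Export all_boot all_order all_algebra.
From mathcomp Require Export all_classical all_reals all_analysis.
Export Order.TTheory GRing.Theory Num.Theory.
Export numFieldNormedType.Exports.

Set Implicit Arguments.
Unset Strict Implicit.
Unset Printing Implicit Defensive.

Local Open Scope classical_set_scope.
Local Open Scope ring_scope.

(* Simple graphs, possibly infinite. Requiring an eqType and a boolean relation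
   loses no generality, since the logic is classical. *)
Record graph := Graph {
  vertex :> eqType;
  adj : rel vertex;
  adj_sym : symmetric adj;
  adj_irr : irreflexive adj }.

Record finGraph := FinGraph {
  fvertex : finType;
  fadj : rel fvertex;
  fadj_sym : symmetric fadj;
  fadj_irr : irreflexive fadj }.

Coercion graph_of_finGraph (G : finGraph) : graph :=
  Graph (@fadj_sym G) (@fadj_irr G).

Definition strong_rel (T U : eqType) (e : rel T) (e' : rel U) : rel (T * U) :=
  fun u v => [&& u != v, (u.1 == v.1) || e u.1 v.1
                       & (u.2 == v.2) || e' u.2 v.2].

Lemma strong_rel_sym (T U : eqType) (e : rel T) (e' : rel U) :
  symmetric e -> symmetric e' -> symmetric (strong_rel e e').
Proof.
move=> es es' u v; rewrite /strong_rel eq_sym (eq_sym u.1) (eq_sym u.2).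
by rewrite es es'.
Qed.

Lemma strong_rel_irr (T U : eqType) (e : rel T) (e' : rel U) :
  irreflexive (strong_rel e e').
Proof. by move=> u; rewrite /strong_rel eqxx. Qed.

Definition strong (G H : graph) : graph :=
  Graph (strong_rel_sym (@adj_sym G) (@adj_sym H))
        (@strong_rel_irr G H (@adj G) (@adj H)).

Definition fstrong (G H : finGraph) : finGraph :=
  FinGraph (strong_rel_sym (@fadj_sym G) (@fadj_sym H))
           (@strong_rel_irr _ _ (@fadj G) (@fadj H)).

Definition edgeless_rel (T : Type) : rel T := fun _ _ => false.

Lemma edgeless_sym (T : Type) : symmetric (@edgeless_rel T).
Proof. by []. Qed.

Lemma edgeless_irr (T : Type) : irreflexive (@edgeless_rel T).
Proof. by []. Qed.

Definition edgeless (n : nat) : finGraph :=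
  FinGraph (@edgeless_sym 'I_n) (@edgeless_irr 'I_n).

(* The 0-th power is the one-vertex graph, the unit of the strong product. *)
Fixpoint strong_pow (G : graph) (n : nat) : graph :=
  if n is n'.+1 then strong G (strong_pow G n') else edgeless 1.

Definition disj_rel (T U : Type) (e : rel T) (e' : rel U) : rel (T + U) :=
  fun u v => match u, v with
    | inl x, inl y => e x y
    | inr x, inr y => e' x y
    | _, _ => false
    end.

Lemma disj_rel_sym (T U : Type) (e : rel T) (e' : rel U) :
  symmetric e -> symmetric e' -> symmetric (disj_rel e e').
Proof. by move=> es es' [u|u] [v|v] //=. Qed.

Lemma disj_rel_irr (T U : Type) (e : rel T) (e' : rel U) :
  irreflexive e -> irreflexive e' -> irreflexive (disj_rel e e').
Proof. by move=> ei ei' [u|u] /=. Qed.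

Definition fdisj (G H : finGraph) : finGraph :=
  FinGraph (disj_rel_sym (@fadj_sym G) (@fadj_sym H))
           (disj_rel_irr (@fadj_irr G) (@fadj_irr H)).

Definition cohomomorphism (G H : graph) (f : G -> H) : Prop :=
  forall u v : G, u != v -> ~~ adj u v -> f u != f v /\ ~~ adj (f u) (f v).

Definition cohom_le (G H : graph) : Prop :=
  exists f : G -> H, cohomomorphism f.

(* The field R only serves to express the asymptotic condition f(n) = o(n). *)
Definition asym_le (R : realType) (G H : graph) : Prop :=
  exists f : nat -> nat,
    (fun n => (f n)%:R : R) =o_\oo (fun n => n%:R : R) /\
    forall n, cohom_le (strong_pow G n) (strong_pow H (n + f n)).

Definition asym_equiv (R : realType) (G H : graph) : Prop :=
  asym_le R G H /\ asym_le R H G.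

(* A predicate rather than a set of functions, because of the universe
   constraints between finType and set. *)
Definition asym_spectrum (R : realType) (F : finGraph -> R) : Prop :=
  [/\ forall G, 0 <= F G,
      forall G H, F (fdisj G H) = F G + F H,
      forall G H, F (fstrong G H) = F G * F H,
      forall n, F (edgeless n) = n%:R
    & forall G H : finGraph, cohom_le G H -> F G <= F H].

(* The set below is bounded, as cohom_le G (edgeless #|fvertex G|) gives
   0 <= F G <= #|fvertex G|, and nonempty, as the fractional clique cover number
   lies in the asymptotic spectrum: sup is the genuine supremum. *)
Definition spec_dist (R : realType) (G H : finGraph) : R :=
  sup [set x : R | exists2 F : finGraph -> R,
                   asym_spectrum F & x = `|F G - F H|].

Definition spec_cvg (R : realType) (G : nat -> finGraph) (H : finGraph) : Prop :=
  spec_dist R (G n) H @[n --> \oo] --> (0 : R).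

(* The complete graph on p vertices when p / q < 2. *)
Definition fraction_rel (p q : nat) : rel 'I_p := fun u v =>
  (u != v) &&
  ((2 * q <= p)%N ==>
     (((u%:Z - v%:Z)%R %% p)%Z < q%:Z) || (((v%:Z - u%:Z)%R %% p)%Z < q%:Z)).

Lemma fraction_rel_sym (p q : nat) : symmetric (@fraction_rel p q).
Proof. by move=> u v; rewrite /fraction_rel eq_sym orbC. Qed.

Lemma fraction_rel_irr (p q : nat) : irreflexive (@fraction_rel p q).
Proof. by move=> u; rewrite /fraction_rel eqxx. Qed.

Definition fraction_graph (p q : nat) : finGraph :=
  FinGraph (@fraction_rel_sym p q) (@fraction_rel_irr p q).

(* The circle of unit circumference is parametrized by [0, 1[. *)
Definition circle (R : realType) := {x : R | 0 <= x < 1}.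

Definition circle_dist (R : realType) (x y : circle R) : R :=
  Num.min `|val x - val y| (1 - `|val x - val y|).

Lemma circle_distC (R : realType) (x y : circle R) :
  circle_dist x y = circle_dist y x.
Proof. by rewrite /circle_dist distrC. Qed.

Definition circle_open_rel (R : realType) (r : R) : rel (circle R) :=
  fun x y => (x != y) && (circle_dist x y < r^-1).

Definition circle_closed_rel (R : realType) (r : R) : rel (circle R) :=
  fun x y => (x != y) && (circle_dist x y <= r^-1).

Lemma circle_open_sym (R : realType) (r : R) : symmetric (circle_open_rel r).
Proof. by move=> x y; rewrite /circle_open_rel eq_sym circle_distC. Qed.

Lemma circle_open_irr (R : realType) (r : R) : irreflexive (circle_open_rel r).
Proof. by move=> x; rewrite /circle_open_rel eqxx. Qed.

Lemma circle_closed_sym (R : realType) (r : R) :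
  symmetric (circle_closed_rel r).
Proof. by move=> x y; rewrite /circle_closed_rel eq_sym circle_distC. Qed.

Lemma circle_closed_irr (R : realType) (r : R) :
  irreflexive (circle_closed_rel r).
Proof. by move=> x; rewrite /circle_closed_rel eqxx. Qed.

Definition circle_open (R : realType) (r : R) : graph :=
  Graph (circle_open_sym r) (circle_open_irr r).

Definition circle_closed (R : realType) (r : R) : graph :=
  Graph (circle_closed_sym r) (circle_closed_irr r).

(* Main.v *)
Require Import Defs.
From HB Require Import structures.
From mathcomp Require Import generic_quotient ring lra zify.

Set Implicit Arguments.
Unset Strict Implicit.
Unset Printing Implicit Defensive.

Local Open Scope classical_set_scope.
Local Open Scope ring_scope.

(** The open circle graph with parameter [p / q] is equivalent to the fraction
    graph [E_(p/q)] (round to a grid, [circle_open_le_fraction], or include the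
    grid, [fraction_le_circle_open]), while the closed one is the limit from
    below of the graphs [E_(a/b)] with [a / b < p / q]: these all map to it
    ([fraction_le_circle_closed]), and a finite graph that maps to one of its
    powers already maps to the same power of some [E_(a/b)]
    ([finite_le_circle_closed_pow]), because finitely many distances that exceed
    [q / p] exceed it by a margin.  Hence (i) and (ii) say the same thing.

    From (ii), each [F] in the asymptotic spectrum satisfies
    [F E_(p/q) ^ n <= F E_(a/b) ^ (n + o(n))] where [a / b < p / q] depends on
    [n] only, so that one well chosen [n] gives the uniform estimate (iii)
    ([pow_sublinear], [spectrum_uniform]).  (iii) is (iv) up to the definition of
    the distance as a supremum over [F], and (iv), applied to one sequence that
    increases to [p / q], gives (v).

    The substance is in the way back from (v) to (ii), which goes from a
    pointwise statement about real-valued [F] to the existence of maps between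
    graphs.  It needs Strassen's duality, in a form that treats the whole family
    of the graphs [E_(a/b)], [a / b < p / q], at once and thereby also absorbs
    the compactness (Dini) argument that would make (v) uniform.  Finite graphs
    up to mutual cohomomorphism form an ordered commutative semiring.  Fix [k]
    and try to extend its order so that [2 E_(a/b) ^ k <= E_(p/q) ^ k] for all
    these [a / b].  If the extension is consistent, Zorn's lemma gives a maximal
    one, which is total ([maximal_total]), and a total order has a monotone
    homomorphism [F] to the reals, given by Dedekind cuts ([cut_real_point]).
    This [F] satisfies [2 sup F E_(a/b) ^ k <= F E_(p/q) ^ k], against (v).  So
    the extension is inconsistent, and the inconsistency, which involves a
    single [a / b], is an inequality in the semiring from which
    [E_(p/q) ^ (k N) <= E_(a/b) ^ ((k + 2) N + c)] follows for all [N]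
    ([duality]).  Letting [k] grow slowly with [n] gives (ii)
    ([diagonal_exponent]). *)

(** * Strassen preorders and their real points *)

(** The field [sp_ge1] is the form that the Archimedean lower bound takes for
    graphs, where a nonempty graph is at least the one-vertex graph. *)
Record strassen (S : comPzSemiRingType) (Q : S -> S -> Prop) : Prop := Strassen {
  sp_refl : forall x, Q x x;
  sp_trans : forall y x z, Q x y -> Q y z -> Q x z;
  sp_add : forall z x y, Q x y -> Q (x + z) (y + z);
  sp_mul : forall z x y, Q x y -> Q (x * z) (y * z);
  sp_ge0 : forall x, Q 0 x;
  sp_ge1 : forall x, x != 0 -> Q 1 x;
  sp_arch : forall x, exists n, Q x n%:R;
  sp_proper : forall n, ~ Q n.+1%:R n%:R }.

Definition real_point (R : realType) (S : comPzSemiRingType) (Q : S -> S -> Prop)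
    (F : S -> R) : Prop :=
  [/\ forall x y, F (x + y) = F x + F y,
      forall x y, F (x * y) = F x * F y,
      forall n, F n%:R = n%:R
    & forall x y, Q x y -> F x <= F y].

Section Strassen.
Variables (S : comPzSemiRingType) (Q : S -> S -> Prop).
Hypothesis spQ : strassen Q.

Lemma sp_addl z x y : Q x y -> Q (z + x) (z + y).
Proof. by rewrite !(addrC z); apply: sp_add. Qed.

Lemma sp_mull z x y : Q x y -> Q (z * x) (z * y).
Proof. by rewrite !(mulrC z); apply: sp_mul. Qed.

Lemma sp_addD x y x' y' : Q x y -> Q x' y' -> Q (x + x') (y + y').
Proof. by move=> h h'; apply: (sp_trans spQ (sp_add spQ _ h)); apply: sp_addl. Qed.

Lemma sp_mulM x y x' y' : Q x y -> Q x' y' -> Q (x * x') (y * y').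
Proof. by move=> h h'; apply: (sp_trans spQ (sp_mul spQ _ h)); apply: sp_mull. Qed.

Lemma sp_exp n x y : Q x y -> Q (x ^+ n) (y ^+ n).
Proof.
move=> h; elim: n => [|n IH]; first by rewrite !expr0; apply: sp_refl.
by rewrite !exprS; apply: sp_mulM.
Qed.

Lemma sp_addr x y : Q x (x + y).
Proof. by rewrite -{1}(addr0 x); apply: sp_addl; apply: sp_ge0. Qed.

Lemma sp_nat m n : (m <= n)%N -> Q m%:R n%:R.
Proof. by move/subnKC=> <-; rewrite natrD; apply: sp_addr. Qed.

Lemma sp_natP m n : Q m%:R n%:R -> (m <= n)%N.
Proof.
move=> h; rewrite leqNgt; apply/negP => /sp_nat h'.
exact: (sp_proper spQ (sp_trans spQ h' h)).
Qed.

End Strassen.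

(** In a ring one would add the elements [b - a], [a] in [D], and their multiples
    to the positive cone, so that [u <= v] when [v - u] is [s * (b - a)] plus
    something positive.  Without subtraction, [s * a] and [s * b] change sides. *)
Definition adjoin (S : comPzSemiRingType) (Q : S -> S -> Prop)
    (D : S -> Prop) (b : S) : S -> S -> Prop :=
  fun u v => exists a s, D a /\ Q (u + s * b) (v + s * a).

Definition directed (S : Type) (Q : S -> S -> Prop) (D : S -> Prop) : Prop :=
  (exists a, D a) /\
  forall a a', D a -> D a' -> exists a'', [/\ D a'', Q a a'' & Q a' a''].

Lemma adjoin_sub (S : comPzSemiRingType) (Q : S -> S -> Prop) D b x y :
  directed Q D -> Q x y -> adjoin Q D b x y.
Proof. by move=> [[a Da] _] h; exists a, 0; rewrite !mul0r !addr0. Qed.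

Lemma adjoin_le (S : comPzSemiRingType) (Q : S -> S -> Prop) (D : S -> Prop) a b :
  strassen Q -> D a -> adjoin Q D b a b.
Proof. by move=> sp Da; exists a, 1; split=> //; rewrite !mul1r addrC; apply: sp_refl. Qed.

(** Transitivity is where directedness enters: two witnesses are replaced by a
    common upper bound before they are added. *)
Lemma adjoin_strassen (S : comPzSemiRingType) (Q : S -> S -> Prop) D b :
  strassen Q -> directed Q D ->
  (forall n, ~ adjoin Q D b n.+1%:R n%:R) -> strassen (adjoin Q D b).
Proof.
move=> sp dir prop; have sub x y : Q x y -> adjoin Q D b x y by exact: adjoin_sub.
split=> //.
- by move=> x; apply: sub; apply: sp_refl.
- move=> y x z [a [s [Da h]]] [a' [s' [Da' h']]].
  have [a'' [Da'' aa'' a'a'']] := dir.2 _ _ Da Da'.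
  exists a'', (s + s'); split=> //.
  have e1 : Q (x + (s + s') * b) (y + s * a + s' * b).
    by rewrite mulrDl addrA; apply: sp_add.
  have e2 : Q (y + s * a + s' * b) (z + s' * a' + s * a).
    by rewrite addrAC; apply: sp_add.
  apply: sp_trans e1 _ => //; apply: sp_trans e2 _ => //.
  rewrite mulrDl addrA addrAC -!addrA; apply: sp_addl => //.
  by apply: sp_addD => //; apply: sp_mull.
- move=> z x y [a [s [Da h]]]; exists a, s; split=> //.
  by rewrite addrAC (addrAC y); apply: sp_add.
- move=> z x y [a [s [Da h]]]; exists a, (s * z); split=> //.
  by rewrite (mulrAC s z b) (mulrAC s z a) -!mulrDl; apply: sp_mul.
- by move=> x; apply: sub; apply: sp_ge0.
- by move=> x x0; apply: sub; apply: sp_ge1.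
- by move=> x; have [n h] := sp_arch sp x; exists n; apply: sub.
Qed.

(** Zorn's lemma: consistency is a condition on single pairs, so it passes to the
    union of a chain. *)
Lemma strassen_maximal (S : comPzSemiRingType) (Q : S -> S -> Prop) :
  strassen Q -> exists Q' : S -> S -> Prop,
    [/\ strassen Q', forall x y, Q x y -> Q' x y
      & forall Q'' : S -> S -> Prop, strassen Q'' ->
          (forall x y, Q' x y -> Q'' x y) -> forall x y, Q'' x y -> Q' x y].
Proof.
move=> sp.
(* The empty relation is admitted so that the empty chain has a union. *)
pose good (A : set (S * S)) := A = set0 \/
  (strassen (fun x y => A (x, y)) /\ forall x y, Q x y -> A (x, y)).
have [A [goodA maxA]] : exists A, good A /\ forall B, A `<` B -> ~ good B.
  apply: Zorn_bigcup => F subF totF.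
  have [[A FA A0]|none] := pselect (exists2 A, F A & A != set0); last first.
    left; apply/seteqP; split=> // z [X FX Xz].
    by case: none; exists X => //; apply/set0P; exists z.
  have ok B z : F B -> B z ->
      strassen (fun x y => B (x, y)) /\ forall x y, Q x y -> B (x, y).
    by move=> FB Bz; case: (subF _ FB) => // B0; rewrite B0 in Bz.
  have /set0P [z Az] := A0; have [spA QA] := ok _ _ FA Az.
  right; split; last by move=> x y h; exists A => //; apply: QA.
  have sub x y : A (x, y) -> (\bigcup_(X in F) X) (x, y) by exists A.
  split.
  - by move=> x; apply: sub; apply: (sp_refl spA).
  - move=> y x w [B FB Bxy] [C FC Cyw].
    have [BC|CB] := totF _ _ FB FC.
      exists C => //; have [spC _] := ok _ _ FC Cyw.
      exact: (sp_trans spC (BC _ Bxy) Cyw).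
    exists B => //; have [spB _] := ok _ _ FB Bxy.
    exact: (sp_trans spB Bxy (CB _ Cyw)).
  - move=> w x y [B FB Bxy]; exists B => //; have [spB _] := ok _ _ FB Bxy.
    exact: (sp_add spB).
  - move=> w x y [B FB Bxy]; exists B => //; have [spB _] := ok _ _ FB Bxy.
    exact: (sp_mul spB).
  - by move=> x; apply: sub; apply: (sp_ge0 spA).
  - by move=> x x0; apply: sub; apply: (sp_ge1 spA).
  - by move=> x; have [n h] := sp_arch spA x; exists n; apply: sub.
  - move=> n [B FB Bn]; have [spB _] := ok _ _ FB Bn.
    exact: (sp_proper spB Bn).
have goodQ : good [set z | Q z.1 z.2] by right; split.
case: goodA => [A0|[spA QA]].
  case: (maxA _ _ goodQ); rewrite A0; split=> // /(_ (0, 0)); apply.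
  exact: (sp_refl sp).
exists (fun x y => A (x, y)); split=> // Q'' sp'' sub x y h.
apply: contrapT => nA; apply: (maxA [set z | Q'' z.1 z.2]).
  by split=> [[u v] /sub //|/(_ (x, y) h)].
by right; split=> // u v /QA /sub.
Qed.

(** If neither [x <= y] nor [y <= x] can be adjoined, the two obstructions,
    scaled to have the same coefficients, add up to [1 + w <= w], which
    contradicts the Archimedean property. *)
Lemma maximal_total (S : comPzSemiRingType) (Q : S -> S -> Prop) :
  strassen Q ->
  (forall Q' : S -> S -> Prop, strassen Q' ->
     (forall x y, Q x y -> Q' x y) -> forall x y, Q' x y -> Q x y) ->
  forall x y, Q x y \/ Q y x.
Proof.
move=> sp maxQ.
have obst x y : ~ Q x y ->
    exists n s, s != 0 /\ Q (n.+1%:R + s * y) (n%:R + s * x).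
  move=> nxy; apply: contrapT => none; apply: nxy.
  have dir : directed Q (eq x).
    by split; [exists x|move=> a a' <- <-; exists x; split=> //; apply: sp_refl].
  apply: (maxQ (adjoin Q (eq x) y)); last exact: adjoin_le.
    apply: adjoin_strassen => // n [_ [s [<- h]]]; apply: none.
    exists n, s; split=> //; apply/eqP => s0; apply: (sp_proper sp (n := n)).
    by move: h; rewrite s0 !mul0r !addr0.
  by move=> u v; apply: adjoin_sub.
move=> x y; apply: contrapT => /not_orP [/obst [n [s [s0 h]]] /obst [m [t [t0 h']]]].
pose w : S := n%:R * t + m%:R * s + s * t * (x + y).
have stp : Q (1 + w) w.
  have e : Q (n.+1%:R * t + m.+1%:R * s + s * t * (x + y)) w.
    have := sp_addD sp (sp_mul sp t h) (sp_mul sp s h').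
    have -> : (n.+1%:R + s * y) * t + (m.+1%:R + t * x) * s =
        n.+1%:R * t + m.+1%:R * s + s * t * (x + y) by ring.
    by have -> : (n%:R + s * x) * t + (m%:R + t * y) * s = w by rewrite /w; ring.
  apply: (sp_trans sp _ e).
  have -> : n.+1%:R * t + m.+1%:R * s + s * t * (x + y) = s + t + w by rewrite /w; ring.
  by apply: sp_add => //; apply: (sp_trans sp (sp_ge1 sp s0)); apply: sp_addr.
have stpn k : Q (k%:R + w) w.
  elim: k => [|k IH]; first by rewrite add0r; apply: sp_refl.
  by rewrite -natr1 -addrA; apply: sp_trans IH => //; apply: sp_addl.
have [N hN] := sp_arch sp w.
apply: (sp_proper sp (n := N)); apply: sp_trans (sp_addr sp _ w) _ => //.
exact: sp_trans (stpn _) hN.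
Qed.

Lemma le_of_inv_nat (R : realType) (x y C : R) :
  (forall t : nat, (0 < t)%N -> x - y <= C / t%:R) -> x <= y.
Proof.
move=> h; rewrite leNgt; apply/negP => yx.
have d0 : 0 < x - y by rewrite subr_gt0.
have [t ht] : exists t : nat, C / (x - y) < t%:R.
  exists (Num.bound `|C / (x - y)|); apply: le_lt_trans (ler_norm _) _.
  exact: archi_boundP (normr_ge0 _).
have := h t.+1 isT; rewrite ler_pdivlMr ?ltr0Sn // leNgt => /negP; apply.
have {}ht : C / (x - y) < t.+1%:R.
  by apply: lt_trans ht _; rewrite ltr_nat.
by rewrite ltr_pdivrMr // mulrC in ht.
Qed.

(** For a total preorder the fractions [r / t] with [r <= t x] and those with
    [t x <= r] form a Dedekind cut; the real number it defines depends on [x]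
    additively and multiplicatively. *)
Section Cut.
Variables (R : realType) (S : comPzSemiRingType) (Q : S -> S -> Prop).
Hypothesis (spQ : strassen Q) (totQ : forall x y, Q x y \/ Q y x).

Definition cut_value (x : S) : R :=
  sup [set z | exists r t : nat, [/\ (0 < t)%N, Q r%:R (x * t%:R) & z = r%:R / t%:R]].

Lemma cut_bounds x r t r' t' : (0 < t)%N -> (0 < t')%N ->
  Q r%:R (x * t%:R) -> Q (x * t'%:R) r'%:R -> r%:R / t%:R <= r'%:R / t'%:R :> R.
Proof.
move=> t0 t'0 h h'.
rewrite ler_pdivrMr ?ltr0n // mulrAC ler_pdivlMr ?ltr0n // -!natrM ler_nat.
apply: (sp_natP spQ); rewrite !natrM.
apply: sp_trans (sp_mul spQ _ h) _ => //.
by rewrite mulrAC; apply: sp_mul.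
Qed.

Lemma cut_approx x t : exists r, Q r%:R (x * t%:R) /\ Q (x * t%:R) r.+1%:R.
Proof.
have ex : exists n, `[< Q (x * t%:R) n%:R >].
  by have [n h] := sp_arch spQ (x * t%:R); exists n; apply/asboolP.
case: (ex_minnP ex) => -[|n] /asboolP h mn.
  exists 0%N; split; first exact: sp_ge0.
  by apply: sp_trans h _ => //; apply: sp_ge0.
exists n; split=> //; case: (totQ n%:R (x * t%:R)) => // /asboolP /mn.
by rewrite ltnn.
Qed.

Lemma cut_value_ge x r t : (0 < t)%N -> Q r%:R (x * t%:R) -> r%:R / t%:R <= cut_value x.
Proof.
move=> t0 h; apply: ub_le_sup; last by exists r, t.
have [r' [_ h']] := cut_approx x 1.
exists (r'.+1%:R / 1%:R) => _ [r1 [t1 [t10 h1 ->]]].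
exact: cut_bounds h1 h'.
Qed.

Lemma cut_value_le x r t : (0 < t)%N -> Q (x * t%:R) r%:R -> cut_value x <= r%:R / t%:R.
Proof.
move=> t0 h; apply: ge_sup.
  by have [r' [h' _]] := cut_approx x 1; exists (r'%:R / 1%:R), r', 1%N.
by move=> _ [r1 [t1 [t10 h1 ->]]]; apply: cut_bounds h1 h.
Qed.

(** All identities for [cut_value] come from this bracketing at scale [1 / t],
    by letting [t] grow. *)
Lemma cut_value_approx x t : (0 < t)%N -> exists r,
  [/\ Q r%:R (x * t%:R), Q (x * t%:R) r.+1%:R,
      r%:R / t%:R <= cut_value x & cut_value x <= r.+1%:R / t%:R].
Proof.
move=> t0; have [r [h h']] := cut_approx x t.
by exists r; split=> //; [apply: cut_value_ge|apply: cut_value_le].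
Qed.

Lemma cut_valueD x y : cut_value (x + y) = cut_value x + cut_value y.
Proof.
have main t : (0 < t)%N ->
    `|cut_value (x + y) - (cut_value x + cut_value y)| <= 2 / t%:R.
  move=> t0; have [r [h1 h2 h3 h4]] := cut_value_approx x t0.
  have [r' [h1' h2' h3' h4']] := cut_value_approx y t0.
  have l : (r + r')%:R / t%:R <= cut_value (x + y).
    by apply: cut_value_ge => //; rewrite natrD mulrDl; apply: sp_addD.
  have u : cut_value (x + y) <= (r.+1 + r'.+1)%:R / t%:R.
    by apply: cut_value_le => //; rewrite natrD mulrDl; apply: sp_addD.
  move: l u h3 h4 h3' h4'; rewrite !natrD -!(natr1) !mulrDl ler_norml => *.
  by apply/andP; split; lra.
apply/eqP; rewrite eq_le; apply/andP; split.
  apply: (@le_of_inv_nat _ _ _ 2) => t /main; exact: le_trans (ler_norm _).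
apply: (@le_of_inv_nat _ _ _ 2) => t /main; apply: le_trans.
by rewrite distrC ler_norm.
Qed.

Lemma cut_value_ge0 x : 0 <= cut_value x.
Proof. by have := cut_value_ge (r := 0) (t := 1) isT (sp_ge0 spQ _); rewrite mul0r. Qed.

Lemma cut_valueM x y : cut_value (x * y) = cut_value x * cut_value y.
Proof.
set a := cut_value x; set b := cut_value y.
have main t : (0 < t)%N ->
    `|cut_value (x * y) - a * b| <= (a + b + 1) / t%:R.
  move=> t0; have [r [h1 h2 h3 h4]] := cut_value_approx x t0.
  have [r' [h1' h2' h3' h4']] := cut_value_approx y t0.
  have tt0 : (0 < t * t)%N by rewrite muln_gt0 t0.
  have l : (r * r')%:R / (t * t)%:R <= cut_value (x * y).
    by apply: cut_value_ge => //; rewrite !natrM mulrACA; apply: sp_mulM.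
  have u : cut_value (x * y) <= (r.+1 * r'.+1)%:R / (t * t)%:R.
    by apply: cut_value_le => //; rewrite !natrM mulrACA; apply: sp_mulM.
  have T1 : (t%:R : R)^-1 <= 1 by rewrite invf_le1 ?ler1n ?ltr0n.
  have T0 : 0 < (t%:R : R)^-1 by rewrite invr_gt0 ltr0n.
  have a0 : 0 <= a by exact: cut_value_ge0.
  have b0 : 0 <= b by exact: cut_value_ge0.
  move: l u h3 h4 h3' h4'; rewrite -/a -/b !natrM -!(natr1) invfM.
  rewrite (mulrACA r%:R) (mulrACA (r%:R + 1)).
  rewrite !(mulrDl _ 1) !mul1r; set T := (t%:R)^-1 in T0 T1 *.
  have : 0 <= r%:R * T by rewrite mulr_ge0 ?ler0n ?ltW.
  have : 0 <= r'%:R * T by rewrite mulr_ge0 ?ler0n ?ltW.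
  move: (r%:R * T) (r'%:R * T) => u v v0 u0 l1 l2 ua au vb bv.
  have m1 : u * v <= a * b by apply: ler_pM.
  have m2 : a * b <= (u + T) * (v + T) by apply: ler_pM.
  have m3 : u * T <= a * T by rewrite ler_pM2r.
  have m4 : v * T <= b * T by rewrite ler_pM2r.
  have m5 : T * T <= T by apply: ler_piMl => //; apply: ltW.
  move: (cut_value (x * y)) l1 l2 => c l1 l2; rewrite ler_norml.
  by apply/andP; split; lra.
apply/eqP; rewrite eq_le; apply/andP; split.
  apply: (@le_of_inv_nat _ _ _ (a + b + 1)) => t /main; exact: le_trans (ler_norm _).
apply: (@le_of_inv_nat _ _ _ (a + b + 1)) => t /main; apply: le_trans.
by rewrite distrC ler_norm.
Qed.

Lemma cut_real_point : real_point Q cut_value.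
Proof.
split; [exact: cut_valueD|exact: cut_valueM| |].
  move=> n; apply: le_anti.
  have := cut_value_le (x := n%:R) (r := n) (t := 1) isT.
  have := cut_value_ge (x := n%:R) (r := n) (t := 1) isT.
  by rewrite divr1 mulr1 => -> //; [move=> ->|]; rewrite //; apply: sp_refl.
move=> x y xy; apply: (@le_of_inv_nat _ _ _ 1) => t t0.
have [r [h1 h2 h3 h4]] := cut_value_approx x t0.
have : r%:R / t%:R <= cut_value y.
  by apply: cut_value_ge => //; apply: sp_trans h1 _ => //; apply: sp_mul.
by move: h4; rewrite -natr1 mulrDl; lra.
Qed.

End Cut.

Theorem strassen_real_point (R : realType) (S : comPzSemiRingType) (Q : S -> S -> Prop) :
  strassen Q -> exists F : S -> R, real_point Q F.
Proof.
move=> sp; have [Q' [sp' sub maxQ']] := strassen_maximal sp.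
have [FD FM Fn mono] := cut_real_point R sp' (maximal_total sp' maxQ').
by exists (cut_value R Q'); split=> // x y /sub /mono.
Qed.

(** Either the relations [2 d ^+ k <= a ^+ k], [d] in [D], can be adjoined all
    at once, and then a real point satisfies them, or a single one of them is
    contradictory.  In the second case the factor [2] and another factor [2],
    which absorbs an additive constant, are paid for with two more factors [d];
    what remains is [t a ^ k <= t d ^ (k + 2)] for some [t], and iterating this
    keeps a single [t] on each side, whatever the power. *)
Theorem duality (R : realType) (S : comPzSemiRingType) (Q : S -> S -> Prop)
    (D : S -> Prop) (a : S) (k : nat) :
  strassen Q -> directed Q D -> (forall d, D d -> Q 2%:R d) ->
  (forall F : S -> R, real_point Q F -> exists2 d, D d & F a ^+ k < 2 * F d ^+ k) ->
  exists2 d, D d & exists c, forall N, Q (a ^+ (k * N)) (d ^+ (k.+2 * N + c)).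
Proof.
move=> sp dir D2 noF.
pose D' y := exists2 d, D d & y = 2%:R * d ^+ k.
have dir' : directed Q D'.
  split; first by have [d Dd] := dir.1; exists (2%:R * d ^+ k), d.
  move=> _ _ [d Dd ->] [d' Dd' ->]; have [e [De de d'e]] := dir.2 _ _ Dd Dd'.
  exists (2%:R * e ^+ k); split; first by exists e.
    by apply: (sp_mull sp); apply: (sp_exp sp).
  by apply: (sp_mull sp); apply: (sp_exp sp).
(* The slack factor 2 is what makes a real point contradict noF. *)
have [n] : exists n, adjoin Q D' (a ^+ k) n.+1%:R n%:R.
  apply: contrapT => /forallNP prop.
  have [F [FD FM Fn mono]] := strassen_real_point R (adjoin_strassen sp dir' prop).
  have FX x m : F (x ^+ m) = F x ^+ m.
    elim: m => [|m IH]; first by rewrite !expr0 (Fn 1%N).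
    by rewrite !exprS FM IH.
  have [|d Dd] := noF F; first by split=> // x y h; apply: mono; apply: adjoin_sub.
  have : D' (2%:R * d ^+ k) by exists d.
  by move=> /(adjoin_le (a ^+ k) sp) /mono; rewrite FM Fn !FX ltNge => ->.
move=> [_ [s [[d Dd ->] h]]].
exists d => //; have d2 := D2 d Dd.
have s0 : s != 0.
  apply/eqP => s0; apply: (sp_proper sp (n := n)).
  by move: h; rewrite s0 !mul0r !addr0.
pose t : S := n.+1%:R * s.
have ns m : Q m%:R (m%:R * s).
  by rewrite -[X in Q X _]mulr1; apply: (sp_mull sp); apply: sp_ge1.
have d1 m : Q 1 (d ^+ m).
  rewrite -[X in Q X _](expr1n _ m); apply: (sp_exp sp).
  by apply: (sp_trans sp _ d2); apply: (sp_nat sp (m := 1)).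
(* Summing h with itself makes its additive constant negligible. *)
have mult m : Q (m%:R * (1 + s * a ^+ k) + n%:R) (m%:R * (s * (2%:R * d ^+ k)) + n%:R).
  elim: m => [|m IH]; first by rewrite !mul0r; apply: (sp_refl sp).
  set X := 1 + _ in IH *; set Y := s * (_ * _) in IH h *.
  have -> : m.+1%:R * X + n%:R = (m%:R * X + n%:R) + X by ring.
  apply: (sp_trans sp (sp_add sp X IH)).
  have -> : m%:R * Y + n%:R + X = m%:R * Y + (n.+1%:R + s * a ^+ k) by rewrite /X; ring.
  have -> : m.+1%:R * Y + n%:R = m%:R * Y + (n%:R + Y) by ring.
  exact: sp_addl.
have ta : Q (t * a ^+ k) (t * d ^+ k.+2).
  apply: (@sp_trans _ _ sp (n.+1%:R * (1 + s * a ^+ k) + n%:R)).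
    apply: (sp_trans sp _ (sp_addr sp _ _)); rewrite /t -mulrA.
    by apply: (sp_mull sp); rewrite addrC; apply: (sp_addr sp).
  apply: (sp_trans sp (mult _)).
  apply: (@sp_trans _ _ sp (t * (4%:R * d ^+ k))); last first.
    rewrite !exprS (mulrA d); apply: (sp_mull sp); apply: (sp_mul sp).
    by rewrite (natrM _ 2 2); apply: (sp_mulM sp).
  have -> : t * (4%:R * d ^+ k) = n.+1%:R * (s * (2%:R * d ^+ k)) + t * (2%:R * d ^+ k).
    by rewrite /t (natrD _ 2 2); ring.
  apply: (sp_addl sp).
  apply: (sp_trans sp (sp_nat sp (leqnSn n))); apply: (sp_trans sp (ns _)).
  rewrite -/t -[X in Q X _]mulr1; apply: (sp_mull sp).
  rewrite -[X in Q X _]mulr1; apply: (sp_mulM sp) => //.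
  exact: (sp_nat sp (m := 1)).
have taN N : Q (t * a ^+ (k * N)) (t * d ^+ (k.+2 * N)).
  elim: N => [|N IH]; first by rewrite !muln0; apply: (sp_refl sp).
  rewrite (mulnS k) (mulnS k.+2) (exprD a k) (exprD d k.+2).
  rewrite (mulrA t (a ^+ k)) (mulrA t (d ^+ k.+2)).
  apply: (sp_trans sp (sp_mul sp _ ta)).
  rewrite (mulrAC t _ (a ^+ _)) (mulrAC t _ (d ^+ (k.+2 * N))).
  exact: (sp_mul sp).
have [c tc] : exists c, Q t (d ^+ c).
  have [c hc] := sp_arch sp t; exists c; apply: sp_trans hc _ => //.
  apply: (sp_trans sp _ (sp_exp sp c d2)); rewrite -natrX.
  by apply: sp_nat => //; apply: ltnW; apply: ltn_expl.
exists c => N; rewrite addnC exprD.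
apply: (@sp_trans _ _ sp (t * a ^+ (k * N))).
  rewrite -[X in Q X _]mul1r; apply: (sp_mul sp).
  apply: sp_trans (sp_nat sp (m := 1) (n := n.+1) _) _ => //; exact: ns.
by apply: sp_trans (taN N) _ => //; apply: (sp_mul sp).
Qed.

(** * Cohomomorphisms and products *)

(** The relation that cohomomorphisms preserve.  Under it, the strong product
    becomes a disjunction over coordinates, which makes the algebra of products
    immediate. *)
Definition sep (G : graph) (u v : G) : bool := (u != v) && ~~ adj u v.

Lemma cohomP (G H : graph) (f : G -> H) :
  (forall u v, sep u v -> sep (f u) (f v)) -> cohomomorphism f.
Proof. by move=> h u v uv nuv; apply/andP/h; rewrite /sep uv. Qed.

Lemma cohom_sep (G H : graph) (f : G -> H) u v :
  cohomomorphism f -> sep u v -> sep (f u) (f v).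
Proof. by move=> h /andP [uv nuv]; apply/andP/h. Qed.

Lemma cohom_le_refl (G : graph) : cohom_le G G.
Proof. by exists id; apply: cohomP. Qed.

Lemma cohom_le_trans (H G K : graph) : cohom_le G H -> cohom_le H K -> cohom_le G K.
Proof.
move=> [f hf] [g hg]; exists (g \o f); apply: cohomP => u v /(cohom_sep hf).
exact: cohom_sep.
Qed.

Lemma strong_sep (G H : graph) (u v : strong G H) :
  sep u v = sep u.1 v.1 || sep u.2 v.2.
Proof.
case: u v => [a x] [b y]; rewrite /sep /= /strong_rel /= xpair_eqE.
by case: (a == b); case: (x == y); case: (adj a b); case: (adj x y).
Qed.

Lemma strong_le (G G' H H' : graph) :
  cohom_le G G' -> cohom_le H H' -> cohom_le (strong G H) (strong G' H').
Proof.
move=> [f hf] [g hg]; exists (fun u => (f u.1, g u.2) : strong G' H').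
apply: cohomP => u v; rewrite !strong_sep /=.
by case/orP => [/(cohom_sep hf) ->|/(cohom_sep hg) ->]; rewrite ?orbT.
Qed.

Lemma strong_pow_le (G H : graph) n :
  cohom_le G H -> cohom_le (strong_pow G n) (strong_pow H n).
Proof. by move=> h; elim: n => [|n IH] /=; [apply: cohom_le_refl|apply: strong_le]. Qed.

Lemma strong_pow_leq (G : graph) (x : G) m n :
  (m <= n)%N -> cohom_le (strong_pow G m) (strong_pow G n).
Proof.
move=> /subnK <-; elim: (n - m)%N => [|k IH]; first exact: cohom_le_refl.
apply: cohom_le_trans IH _; rewrite addSn /=.
exists (fun u => (x, u) : strong G _); apply: cohomP => u v.
by rewrite strong_sep /= => ->; rewrite orbT.
Qed.

Fixpoint fstrong_pow (G : finGraph) (n : nat) : finGraph :=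
  if n is n'.+1 then fstrong G (fstrong_pow G n') else edgeless 1.

Lemma fstrong_powE (G : finGraph) n : graph_of_finGraph (fstrong_pow G n) = strong_pow G n.
Proof. by elim: n => //= n <-. Qed.

Lemma edgeless_sep n (i j : edgeless n) : sep i j = (i != j).
Proof. by rewrite /sep andbT. Qed.

Lemma edgeless_le (m n : nat) : cohom_le (edgeless m) (edgeless n) -> (m <= n)%N.
Proof.
move=> [f hf]; have inj : injective f.
  move=> i j fij; apply/eqP; apply: contraT; rewrite -edgeless_sep => /(cohom_sep hf).
  by rewrite /sep fij eqxx.
by have := leq_card (f : 'I_m -> 'I_n) inj; rewrite !card_ord.
Qed.

Lemma edgeless1_le (G : graph) (x : G) : cohom_le (edgeless 1) G.
Proof. by exists (fun=> x); apply: cohomP => i j; rewrite edgeless_sep !ord1. Qed.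

Lemma le_edgeless (G : finGraph) : cohom_le G (edgeless #|fvertex G|).
Proof.
exists (fun x : G => enum_rank (x : fvertex G) : edgeless _); apply: cohomP => u v.
by rewrite edgeless_sep (inj_eq enum_rank_inj) => /andP [].
Qed.

Lemma empty_le (G H : graph) : (G -> False) -> cohom_le G H.
Proof. by move=> h; exists (fun x : G => False_rect H (h x)) => x; case: (h x). Qed.

(** * The ordered semiring of finite graphs *)

(** Finite graphs form a large type, while the quotient and the sets of relations
    used with Zorn's lemma require a small one.  A number of vertices and a list
    of edges determine a finite graph up to isomorphism. *)
Definition code : Set := (nat * seq (nat * nat))%type.

Definition decode_rel (c : code) : rel 'I_c.1 :=
  fun i j => (i != j) &&
    (((i : nat, j : nat) \in c.2) || ((j : nat, i : nat) \in c.2)).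

Lemma decode_sym (c : code) : symmetric (@decode_rel c).
Proof. by move=> i j; rewrite /decode_rel eq_sym orbC. Qed.

Lemma decode_irr (c : code) : irreflexive (@decode_rel c).
Proof. by move=> i; rewrite /decode_rel eqxx. Qed.

Definition decode (c : code) : finGraph := FinGraph (@decode_sym c) (@decode_irr c).

Definition encode (G : finGraph) : code :=
  (#|fvertex G|, [seq (enum_rank e.1 : nat, enum_rank e.2 : nat) |
                  e <- enum [pred e : fvertex G * fvertex G | fadj e.1 e.2]]).

Lemma encode_adj (G : finGraph) (x y : fvertex G) :
  ((enum_rank x : nat, enum_rank y : nat) \in (encode G).2) = fadj x y.
Proof.
apply/mapP/idP => [[[u v]]|xy]; last by exists (x, y); rewrite ?mem_enum.
by rewrite mem_enum => /= uv [/val_inj/enum_rank_inj -> /val_inj/enum_rank_inj ->].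
Qed.

Definition cohom_equiv (G H : graph) : Prop := cohom_le G H /\ cohom_le H G.

Lemma encodeK (G : finGraph) : cohom_equiv G (decode (encode G)).
Proof.
have sepE (x y : fvertex G) :
    sep (G := decode (encode G)) (enum_rank x) (enum_rank y) = sep (G := G) x y.
  rewrite /sep /= /decode_rel !encode_adj (inj_eq enum_rank_inj) (fadj_sym y) orbb.
  by case: (x == y).
split; first by exists (fun x : G => enum_rank (x : fvertex G)); apply: cohomP => x y; rewrite sepE.
exists (fun i : decode (encode G) => enum_val (i : 'I_#|fvertex G|)).
by apply: cohomP => i j; rewrite -sepE !enum_valK.
Qed.

Definition code_equiv (c d : code) : bool := `[< cohom_equiv (decode c) (decode d) >].

Lemma code_equiv_refl : reflexive code_equiv.
Proof. by move=> c; apply/asboolP; split; apply: cohom_le_refl. Qed.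

Lemma code_equiv_sym : symmetric code_equiv.
Proof. by move=> c d; apply/asboolP/asboolP => -[]. Qed.

Lemma code_equiv_trans : transitive code_equiv.
Proof.
move=> d c e /asboolP [cd dc] /asboolP [de ed]; apply/asboolP.
by split; [apply: cohom_le_trans de|apply: cohom_le_trans dc].
Qed.

Canonical code_equiv_rel := EquivRel code_equiv code_equiv_refl code_equiv_sym code_equiv_trans.

(** Mutual cohomomorphism, coarser than isomorphism, is the equivalence that
    turns the preorder of graphs into an order on a semiring. *)
Definition gclass := {eq_quot code_equiv}%qT.
HB.instance Definition _ := Choice.on gclass.

Definition class_of (G : finGraph) : gclass := \pi_gclass%qT (encode G).
Definition rep (x : gclass) : finGraph := decode (repr x).

Lemma class_ofP (G H : finGraph) : class_of G = class_of H <-> cohom_equiv G H.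
Proof.
have [Gc cG] := encodeK G; have [Hc cH] := encodeK H.
split.
  move=> /eqmodP /asboolP [cd dc]; split.
    exact: (cohom_le_trans Gc (cohom_le_trans cd cH)).
  exact: (cohom_le_trans Hc (cohom_le_trans dc cG)).
move=> [GH HG]; apply/eqmodP/asboolP; split.
  exact: (cohom_le_trans cG (cohom_le_trans GH Hc)).
exact: (cohom_le_trans cH (cohom_le_trans HG Gc)).
Qed.

Lemma class_of_rep x : class_of (rep x) = x.
Proof.
rewrite /class_of /rep -[RHS]reprK; apply/eqmodP/asboolP.
by have [a b] := encodeK (decode (repr x)); split.
Qed.

Lemma rep_class_of (G : finGraph) : cohom_equiv (rep (class_of G)) G.
Proof. by apply/class_ofP; rewrite class_of_rep. Qed.

Lemma fdisj_le (G G' H H' : finGraph) :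
  cohom_le G G' -> cohom_le H H' -> cohom_le (fdisj G H) (fdisj G' H').
Proof.
move=> [f hf] [g hg].
exists (fun u : fdisj G H => match u with inl x => inl (f x) | inr y => inr (g y) end
  : fdisj G' H').
by apply: cohomP => -[u|u] [v|v] //; [apply: (cohom_sep hf)|apply: (cohom_sep hg)].
Qed.

Lemma fstrong_le (G G' H H' : finGraph) :
  cohom_le G G' -> cohom_le H H' -> cohom_le (fstrong G H) (fstrong G' H').
Proof. exact: strong_le. Qed.

(** Isomorphisms; the semiring laws of the two products come from these. *)
Lemma equiv_of_bij (G H : graph) (f : G -> H) (g : H -> G) :
  cancel f g -> cancel g f -> (forall u v, sep (f u) (f v) = sep u v) -> cohom_equiv G H.
Proof.
move=> fK gK h; split; first by exists f; apply: cohomP => u v; rewrite h.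
by exists g; apply: cohomP => u v; rewrite -h !gK.
Qed.

Definition gadd (x y : gclass) : gclass := class_of (fdisj (rep x) (rep y)).
Definition gmul (x y : gclass) : gclass := class_of (fstrong (rep x) (rep y)).

Lemma class_of_disj (G H : finGraph) :
  class_of (fdisj G H) = gadd (class_of G) (class_of H).
Proof.
have [a b] := rep_class_of G; have [c d] := rep_class_of H.
by apply/class_ofP; split; apply: fdisj_le.
Qed.

Lemma class_of_strong (G H : finGraph) :
  class_of (fstrong G H) = gmul (class_of G) (class_of H).
Proof.
have [a b] := rep_class_of G; have [c d] := rep_class_of H.
by apply/class_ofP; split; apply: fstrong_le.
Qed.

Lemma gaddA : associative gadd.
Proof.
move=> x y z; rewrite -(class_of_rep x) -(class_of_rep y) -(class_of_rep z).
rewrite -!class_of_disj; apply/class_ofP.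
move: (rep x) (rep y) (rep z) => G H K.
apply: (@equiv_of_bij _ _
  (fun u : fdisj G (fdisj H K) => match u with
     inl a => inl (inl a) | inr (inl b) => inl (inr b) | inr (inr c) => inr c end
     : fdisj (fdisj G H) K)
  (fun u : fdisj (fdisj G H) K => match u with
     inl (inl a) => inl a | inl (inr b) => inr (inl b) | inr c => inr (inr c) end
     : fdisj G (fdisj H K))).
- by case=> [|[]].
- by case=> [[]|].
- by case=> [a|[a|a]] [b|[b|b]].
Qed.

Lemma gaddC : commutative gadd.
Proof.
move=> x y; rewrite -(class_of_rep x) -(class_of_rep y).
rewrite -!class_of_disj; apply/class_ofP; move: (rep x) (rep y) => G H.
apply: (@equiv_of_bij _ _
  (fun u : fdisj G H => match u with inl a => inr a | inr b => inl b end : fdisj H G)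
  (fun u : fdisj H G => match u with inl a => inr a | inr b => inl b end : fdisj G H)).
- by case.
- by case.
- by move=> [a|a] [b|b].
Qed.

Lemma gadd0 : left_id (class_of (edgeless 0)) gadd.
Proof.
move=> x; rewrite -(class_of_rep x) -class_of_disj; apply/class_ofP.
move: (rep x) => G; split.
  exists (fun u : fdisj (edgeless 0) G =>
    match u with inl i => False_rect _ (notF (ltn_ord i)) | inr a => a end : G).
  by apply: cohomP => -[[]|a] // [[]|b].
by exists (fun a : G => inr a : fdisj (edgeless 0) G); apply: cohomP.
Qed.

Lemma gmulA : associative gmul.
Proof.
move=> x y z; rewrite -(class_of_rep x) -(class_of_rep y) -(class_of_rep z).
rewrite -!class_of_strong; apply/class_ofP.
move: (rep x) (rep y) (rep z) => G H K.
apply: (@equiv_of_bij (strong G (strong H K)) (strong (strong G H) K)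
  (fun u => ((u.1, u.2.1), u.2.2)) (fun u => (u.1.1, (u.1.2, u.2)))).
- by case=> [? []].
- by case=> [[]].
- by move=> u v; rewrite !strong_sep /= orbA.
Qed.

Lemma gmulC : commutative gmul.
Proof.
move=> x y; rewrite -(class_of_rep x) -(class_of_rep y).
rewrite -!class_of_strong; apply/class_ofP; move: (rep x) (rep y) => G H.
apply: (@equiv_of_bij (strong G H) (strong H G) (fun u => (u.2, u.1)) (fun u => (u.2, u.1))).
- by case.
- by case.
- by move=> u v; rewrite !strong_sep /= orbC.
Qed.

Lemma gmul1 : left_id (class_of (edgeless 1)) gmul.
Proof.
move=> x; rewrite -(class_of_rep x) -class_of_strong; apply/class_ofP.
move: (rep x) => G.
apply: (@equiv_of_bij (strong (edgeless 1) G) G snd (fun a => (ord0, a))) => //.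
  by case=> i a; rewrite (ord1 i).
by move=> u v; rewrite strong_sep edgeless_sep !ord1.
Qed.

Lemma gmulDl : left_distributive gmul gadd.
Proof.
move=> x y z; rewrite -(class_of_rep x) -(class_of_rep y) -(class_of_rep z).
rewrite -!(class_of_disj, class_of_strong); apply/class_ofP.
move: (rep x) (rep y) (rep z) => G H K.
apply: (@equiv_of_bij (strong (fdisj G H) K) _
  (fun u => match u with (inl a, c) => inl (a, c) | (inr b, c) => inr (b, c) end
     : fdisj (fstrong G K) (fstrong H K))
  (fun u : fdisj (fstrong G K) (fstrong H K) =>
     match u with inl a => (inl a.1, a.2) | inr b => (inr b.1, b.2) end)).
- by case=> [[]].
- by case=> [[]|[]].
- move=> [[a|a] c] [[b|b] d]; rewrite (strong_sep (G := fdisj G H)) //.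
    exact: (@strong_sep G K (a, c) (b, d)).
  exact: (@strong_sep H K (a, c) (b, d)).
Qed.

Lemma gmul0 : left_zero (class_of (edgeless 0)) gmul.
Proof.
move=> x; rewrite -(class_of_rep x) -class_of_strong; apply/class_ofP.
by split; apply: empty_le; [case=> -[]|case].
Qed.

HB.instance Definition _ := GRing.isNmodule.Build gclass gaddA gaddC gadd0.
HB.instance Definition _ :=
  GRing.Nmodule_isComPzSemiRing.Build gclass gmulA gmulC gmul1 gmulDl gmul0.

Lemma class_ofD (G H : finGraph) : class_of (fdisj G H) = class_of G + class_of H.
Proof. exact: class_of_disj. Qed.

Lemma class_ofM (G H : finGraph) : class_of (fstrong G H) = class_of G * class_of H.
Proof. exact: class_of_strong. Qed.

Lemma class_of_nat n : class_of (edgeless n) = n%:R.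
Proof.
elim: n => // n IH; rewrite -natr1 -IH addrC -[1]/(class_of (edgeless 1)) -class_ofD.
apply/class_ofP; split.
  exists (fun i : edgeless n.+1 => match unlift ord0 i with
    None => inl ord0 | Some j => inr j end : fdisj (edgeless 1) (edgeless n)).
  apply: cohomP => i j; rewrite edgeless_sep => ij.
  case: unliftP ij => [i' ->|->]; case: unliftP => [j' ->|->] // ij.
  by rewrite /sep /= andbT; apply: contraNneq ij => -[->].
exists (fun u : fdisj (edgeless 1) (edgeless n) => match u with
  inl _ => ord0 | inr j => lift ord0 j end : edgeless n.+1).
apply: cohomP => -[i|i] [j|j]; rewrite edgeless_sep //.
  by rewrite /sep !ord1 eqxx.
by rewrite (inj_eq lift_inj) /sep andbT; apply: contra => /eqP ->.
Qed.

Lemma class_of0 : class_of (edgeless 0) = 0. Proof. exact: class_of_nat. Qed.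

Lemma class_of1 : class_of (edgeless 1) = 1. Proof. exact: class_of_nat. Qed.

Lemma class_ofX (G : finGraph) n : class_of (fstrong_pow G n) = class_of G ^+ n.
Proof. by elim: n => [|n IH] //; rewrite exprS -IH -class_ofM. Qed.

Definition gle (x y : gclass) : Prop := cohom_le (rep x) (rep y).

Lemma gleP (G H : finGraph) : gle (class_of G) (class_of H) <-> cohom_le G H.
Proof.
have [a b] := rep_class_of G; have [c d] := rep_class_of H.
split=> h; first by exact: (cohom_le_trans b (cohom_le_trans h c)).
exact: (cohom_le_trans a (cohom_le_trans h d)).
Qed.

(** Consistency is the pigeonhole principle, and the Archimedean bound holds
    because a graph maps to the edgeless graph on its vertices. *)
Lemma gle_strassen : strassen gle.
Proof.
split.
- by move=> x; apply: cohom_le_refl.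
- by move=> y x z; apply: cohom_le_trans.
- move=> z x y; rewrite -(class_of_rep x) -(class_of_rep y) -(class_of_rep z).
  rewrite -!class_ofD !gleP => h; apply: fdisj_le => //; exact: cohom_le_refl.
- move=> z x y; rewrite -(class_of_rep x) -(class_of_rep y) -(class_of_rep z).
  rewrite -!class_ofM !gleP => h; apply: fstrong_le => //; exact: cohom_le_refl.
- move=> x; rewrite -(class_of_rep x) -(class_of0) gleP.
  by apply: empty_le; case.
- move=> x; rewrite -(class_of_rep x) -(class_of1) gleP => /eqP nx.
  apply: contrapT => nle; apply: nx; rewrite -(class_of0).
  apply/class_ofP; split; apply: empty_le; last by case.
  by move=> u; apply: nle; apply: (edgeless1_le u).
- move=> x; exists #|fvertex (rep x)|; rewrite -(class_of_rep x) -class_of_nat.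
  by rewrite gleP class_of_rep; apply: le_edgeless.
- by move=> n; rewrite -!class_of_nat gleP => /edgeless_le; rewrite ltnn.
Qed.

Lemma real_point_spectrum (R : realType) (F : gclass -> R) :
  real_point gle F -> asym_spectrum (fun G : finGraph => F (class_of G)).
Proof.
move=> [FD FM Fn mono]; split.
- by move=> G; have <- : F 0 = 0 := Fn 0%N; apply: mono; exact: (sp_ge0 gle_strassen).
- by move=> G H; rewrite class_ofD FD.
- by move=> G H; rewrite class_ofM FM.
- by move=> n; rewrite class_of_nat Fn.
- by move=> G H /gleP; apply: mono.
Qed.

(** * Duality for families of graphs *)

Theorem graph_duality (R : realType) (D : finGraph -> Prop) (A : finGraph) (k : nat) :
  (exists G, D G) ->
  (forall G H, D G -> D H -> exists K : finGraph, [/\ D K, cohom_le G K & cohom_le H K]) ->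
  (forall G : finGraph, D G -> cohom_le (edgeless 2) G) ->
  (forall F : finGraph -> R, asym_spectrum F ->
     exists2 G, D G & F A ^+ k < 2 * F G ^+ k) ->
  exists2 G, D G & exists c, forall N,
    cohom_le (strong_pow A (k * N)) (strong_pow G (k.+2 * N + c)).
Proof.
move=> [G0 DG0] dir D2 noF.
pose D' x := exists2 G, D G & x = class_of G.
have [||F Fpt|_ [G DG ->] [c h]] := @duality R _ gle D' (class_of A) k gle_strassen.
- split; first by exists (class_of G0), G0.
  move=> _ _ [G DG ->] [H DH ->]; have [K [DK GK HK]] := dir _ _ DG DH.
  by exists (class_of K); split; [exists K|apply/gleP|apply/gleP].
- by move=> _ [G /D2 h ->]; rewrite -class_of_nat gleP.
- have [G DG h] := noF _ (real_point_spectrum Fpt).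
  by exists (class_of G) => //; exists G.
exists G => //; exists c => N; move: (h N).
by rewrite -!class_ofX gleP !fstrong_powE.
Qed.

(** * Fraction graphs and circle graphs *)

Lemma sep_sym (G : graph) (u v : G) : sep u v = sep v u.
Proof. by rewrite /sep eq_sym adj_sym. Qed.

Lemma fraction_sep p q (u v : fraction_graph p q) :
  (0 < q)%N -> (2 * q <= p)%N -> (u < v)%N ->
  sep u v = (u + q <= v)%N && (v + q <= u + p)%N.
Proof.
move=> q0 pq uv; have [up vp] := (ltn_ord u, ltn_ord v).
have e1 : ((v%:Z - u%:Z)%R %% p)%Z = (v%:Z - u%:Z)%R by apply: modz_small; lia.
have e2 : ((u%:Z - v%:Z)%R %% p)%Z = (u%:Z - v%:Z + p%:Z)%R.
  by rewrite -modzDr; apply: modz_small; lia.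
have neq : (u != v) by rewrite -val_eqE /= neq_ltn uv.
rewrite /sep /= /fraction_rel neq pq /= e1 e2; lia.
Qed.

Lemma fraction_cohomP p q (H : graph) (f : fraction_graph p q -> H) :
  (0 < q)%N ->
  (forall u v : fraction_graph p q, (2 * q <= p)%N -> (u + q <= v)%N ->
     (v + q <= u + p)%N -> sep (f u) (f v)) -> cohomomorphism f.
Proof.
move=> q0 h; apply: cohomP => u v; case: (leqP (2 * q) p) => pq; last first.
  by rewrite /sep /= /fraction_rel leqNgt pq /= andbT andbN.
wlog uv : u v / (u < v)%N.
  move=> w; case: (ltngtP u v) => [|vu|/val_inj ->]; first exact: w.
    by rewrite (sep_sym u) (sep_sym (f u)); apply: w.
  by rewrite /sep eqxx.
by rewrite fraction_sep // => /andP [a b]; apply: h.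
Qed.

(** Multiplication by [c / a] followed by rounding down maps a cyclic distance of
    at least [b] out of [a] to one of at least [d] out of [c], since
    [b * c / a >= d]. *)
Lemma fraction_le a b c d :
  (0 < b)%N -> (0 < c)%N -> (0 < d)%N -> (a * d <= c * b)%N ->
  cohom_le (fraction_graph a b) (fraction_graph c d).
Proof.
move=> b0 c0 d0 h.
have lt (u : fraction_graph a b) : (u * c %/ a < c)%N.
  have ua := ltn_ord u.
  by rewrite ltn_divLR ?(leq_ltn_trans _ ua) // mulnC ltn_mul2l c0.
exists (fun u => Ordinal (lt u) : fraction_graph c d).
apply: fraction_cohomP => // u v ab uv vu.
have a0 : (0 < a)%N by exact: leq_ltn_trans (ltn_ord u).
have cd : (2 * d <= c)%N by nia.
have uv' : (u * c %/ a + d <= v * c %/ a)%N.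
  by rewrite addnC -divnMDl //; apply: leq_div2r; nia.
have vu' : (v * c %/ a + d <= u * c %/ a + c)%N.
  rewrite addnC -divnMDl // (addnC _ c) -divnMDl //; apply: leq_div2r; nia.
by rewrite fraction_sep //= ?uv' //; lia.
Qed.

Lemma edgeless2_le_fraction a b :
  (0 < b)%N -> (2 * b <= a)%N -> cohom_le (edgeless 2) (fraction_graph a b).
Proof.
move=> b0 ab; have h0 : (0 < a)%N by lia.
have hb : (b < a)%N by lia.
exists (fun i : edgeless 2 => (if i == ord0 :> 'I_2 then Ordinal h0 else Ordinal hb)
  : fraction_graph a b).
have s : sep (Ordinal h0 : fraction_graph a b) (Ordinal hb).
  by rewrite fraction_sep //=; lia.
apply: cohomP => -[[|[|//]] ?] [[|[|//]] ?] //= _; by rewrite sep_sym.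
Qed.

Section Circle.
Variable R : realType.

Lemma circle_open_sep (r : R) (x y : circle_open r) : val x < val y ->
  sep x y = (r^-1 <= val y - val x) && (r^-1 <= 1 - (val y - val x)).
Proof.
move=> xy; have neq : (x != y) by rewrite -val_eqE /= lt_eqF.
rewrite /sep /= /circle_open_rel neq /= -leNgt /circle_dist distrC gtr0_norm ?subr_gt0 //.
by rewrite le_min.
Qed.

Lemma circle_closed_sep (r : R) (x y : circle_closed r) : val x < val y ->
  sep x y = (r^-1 < val y - val x) && (r^-1 < 1 - (val y - val x)).
Proof.
move=> xy; have neq : (x != y) by rewrite -val_eqE /= lt_eqF.
rewrite /sep /= /circle_closed_rel neq /= -ltNge /circle_dist distrC gtr0_norm ?subr_gt0 //.
by rewrite lt_min.
Qed.

Lemma circle_closed_le_open (r : R) : cohom_le (circle_closed r) (circle_open r).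
Proof.
exists (fun x : circle R => x); apply: cohomP => x y.
rewrite /sep /= /circle_closed_rel /circle_open_rel.
case: (x == y) => //=; apply: contra; exact: ltW.
Qed.

Lemma grid_subproof (N : nat) (x : circle R) :
  (0 < N)%N -> (Num.truncn (val x * N%:R) < N)%N.
Proof.
move=> N0; case/andP: (valP x) => x0 x1.
by rewrite truncn_lt_nat ?mulr_ge0 // gtr_pMl ?ltr0n.
Qed.

Definition grid (N b : nat) (N0 : (0 < N)%N) (x : circle R) : fraction_graph N b :=
  Ordinal (grid_subproof x N0).

(** Rounding down to a multiple of [1 / N] does not bring a distance that is at
    least [b / N] below [b / N]. *)
Lemma grid_sep (N b : nat) (N0 : (0 < N)%N) (x y : circle R) :
  (0 < b)%N -> (2 * b <= N)%N ->
  val x * N%:R + b%:R <= val y * N%:R ->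
  val y * N%:R + b%:R <= val x * N%:R + N%:R ->
  sep (grid b N0 x) (grid b N0 y).
Proof.
move=> b0 bN; case/andP: (valP x) => x0 _; case/andP: (valP y) => y0 _.
have shift (z w : R) (c d : nat) : 0 <= z -> 0 <= w -> z + c%:R <= w + d%:R ->
    (Num.truncn z + c <= Num.truncn w + d)%N.
  move=> z0 w0 zw; have [w1 w2] := andP (truncn_itv w0).
  have [z1 z2] := andP (truncn_itv z0).
  rewrite -ltnS -(ltr_nat R) -addSn !natrD; lra.
move=> xy yx.
have {}xy : (grid b N0 x + b <= grid b N0 y)%N.
  by have := @shift _ _ b 0%N _ _ (_ : _ <= val y * N%:R + 0); rewrite addn0; apply;
    rewrite ?mulr_ge0 // addr0.
have {}yx : (grid b N0 y + b <= grid b N0 x + N)%N.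
  by apply: shift; rewrite ?mulr_ge0.
by rewrite fraction_sep ?xy //; lia.
Qed.

Lemma circle_open_le_fraction (p q : nat) :
  (0 < q)%N -> (2 * q <= p)%N ->
  cohom_le (circle_open (p%:R / q%:R : R)) (fraction_graph p q).
Proof.
move=> q0 pq; have p0 : (0 < p)%N by lia.
exists (grid q p0); apply: cohomP => x y.
wlog xy : x y / val x < val y.
  move=> w; case: (ltgtP (val x) (val y)) => [|yx|/val_inj ->]; first exact: w.
    by rewrite (sep_sym x) (sep_sym (grid q p0 x)); apply: w.
  by rewrite /sep eqxx.
rewrite circle_open_sep // invf_div !ler_pdivrMr ?ltr0n // => /andP [h1 h2].
apply: grid_sep => //; lra.
Qed.

Lemma circle_point_subproof (a : nat) (u : 'I_a) : 0 <= (u%:R / a%:R : R) < 1.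
Proof.
have a0 : (0 < a)%N by exact: leq_ltn_trans (ltn_ord u).
by rewrite divr_ge0 //= ltr_pdivrMr ?ltr0n // mul1r ltr_nat.
Qed.

Definition circle_point (a : nat) (u : 'I_a) : circle R :=
  exist (fun x : R => is_true (0 <= x < 1)) _ (circle_point_subproof u).

Lemma circle_point_dist (a b : nat) (u v : 'I_a) :
  (u + b <= v)%N -> (v + b <= u + a)%N ->
  b%:R / a%:R <= val (circle_point v) - val (circle_point u) /\
  b%:R / a%:R <= 1 - (val (circle_point v) - val (circle_point u)).
Proof.
have a0 : 0 < a%:R :> R by rewrite ltr0n; apply: leq_ltn_trans (ltn_ord u).
move=> uv vu /=; rewrite -mulrBl; split.
  by rewrite ler_pM2r ?invr_gt0 // lerBrDl -natrD ler_nat.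
rewrite -[X in X - _](divff (lt0r_neq0 a0)) -mulrBl ler_pM2r ?invr_gt0 //.
by move: vu; rewrite -(ler_nat R) !natrD; lra.
Qed.

Lemma circle_point_lt (a b : nat) (u v : 'I_a) :
  (0 < b)%N -> (u + b <= v)%N -> val (circle_point u) < val (circle_point v).
Proof.
move=> b0 uv; have a0 : (0 < a)%N by exact: leq_ltn_trans (ltn_ord u).
by rewrite /= ltr_pM2r ?invr_gt0 ?ltr0n // ltr_nat; lia.
Qed.

Lemma fraction_le_circle_closed (a b : nat) (r : R) :
  (0 < a)%N -> (0 < b)%N -> a%:R / b%:R < r ->
  cohom_le (fraction_graph a b) (circle_closed r).
Proof.
move=> a0 b0 abr.
have ab0 : 0 < a%:R / b%:R :> R by rewrite divr_gt0 ?ltr0n.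
have rba : r^-1 < b%:R / a%:R.
  by rewrite -(invf_div a%:R b%:R) ltf_pV2 ?posrE //; apply: lt_trans abr.
exists (fun u : fraction_graph a b => circle_point u : circle_closed r).
apply: fraction_cohomP => // u v _ uv vu; have [h1 h2] := circle_point_dist uv vu.
rewrite circle_closed_sep ?(circle_point_lt b0 uv) //.
by apply/andP; split; apply: lt_le_trans rba _.
Qed.

Lemma fraction_le_circle_open (a b : nat) :
  (0 < b)%N -> cohom_le (fraction_graph a b) (circle_open (a%:R / b%:R : R)).
Proof.
move=> b0; exists (fun u : fraction_graph a b => circle_point u : circle_open _).
apply: fraction_cohomP => // u v _ uv vu; have [h1 h2] := circle_point_dist uv vu.
by rewrite circle_open_sep ?invf_div ?h1 // (circle_point_lt b0 uv).
Qed.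

End Circle.

Fixpoint pow_map (G H : graph) (g : G -> H) n : strong_pow G n -> strong_pow H n :=
  if n is n'.+1 then fun u => (g u.1, pow_map g u.2) else id.

Fixpoint coords (G : graph) n : strong_pow G n -> seq G :=
  if n is n'.+1 then fun u => u.1 :: coords u.2 else fun=> [::].

Lemma pow_map_sep (G H : graph) (g : G -> H) n (u v : strong_pow G n) :
  {in coords u & coords v, forall x y, sep x y -> sep (g x) (g y)} ->
  sep u v -> sep (pow_map g u) (pow_map g v).
Proof.
elim: n u v => [|n IH] u v /= h.
  by rewrite !edgeless_sep.
rewrite !strong_sep /= => /orP [uv|uv].
  by rewrite h ?mem_head.
by rewrite IH ?orbT // => x y xu yv; apply: h; rewrite inE ?xu ?yv orbT.
Qed.

Lemma eventually_all (T : eqType) (s : seq T) (P : T -> nat -> Prop) :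
  {in s, forall x, exists M, forall N, (M <= N)%N -> P x N} ->
  exists M, forall N, (M <= N)%N -> {in s, forall x, P x N}.
Proof.
elim: s => [|x s IH] h; first by exists 0%N.
have [M1 h1] := h x (mem_head _ _).
have [|M2 h2] := IH; first by move=> y ys; apply: h; rewrite inE ys orbT.
exists (maxn M1 M2) => N; rewrite geq_max => /andP [N1 N2] y.
by rewrite inE => /predU1P [->|]; [exact: h1|exact: h2].
Qed.

(** The finitely many distances that exceed [q / p] exceed it by a margin, which
    a fine enough grid of [N] points respects when [b / N] is the least fraction
    with denominator [N] above [q / p]. *)
Lemma circle_closed_discretize (R : realType) (p q : nat) (s : seq (circle R)) :
  (0 < q)%N -> (2 * q < p)%N ->
  exists a b (g : circle R -> fraction_graph a b),
    [/\ (0 < a)%N, (0 < b)%N, (a * q < p * b)%N &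
      {in s &, forall x y : circle_closed (p%:R / q%:R : R), sep x y -> sep (g x) (g y)}].
Proof.
move=> q0 pq; have p0 : (0 < p)%N by lia.
have p0' : 0 < p%:R :> R by rewrite ltr0n.
have q0' : 0 < q%:R :> R by rewrite ltr0n.
(* The successor makes b N / N strictly larger than q / p. *)
pose b N := (N * q %/ p).+1.
have bleq N : (b N)%:R <= N%:R * (q%:R / p%:R) + 1 :> R.
  rewrite /b -natr1 lerD2r mulrA ler_pdivlMr // -!natrM ler_nat.
  exact: leq_trunc_div.
have big (e : R) : 0 < e -> exists M, forall N, (M <= N)%N -> 1 <= e * N%:R.
  move=> e0; exists (Num.bound e^-1) => N MN.
  rewrite -ler_pdivrMl // mulr1; apply: ltW.
  by apply: lt_le_trans (archi_boundP _) _; rewrite ?ler_nat // invr_ge0 ltW.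
have [M1 hM1] : exists M, forall N, (M <= N)%N -> (2 * b N <= N)%N.
  have [|M hM] := big (2^-1 - q%:R / p%:R).
    rewrite subr_gt0 ltr_pdivrMr // ltr_pdivlMl // -natrM ltr_nat; lia.
  exists M => N /hM h; rewrite -(ler_nat R) natrM.
  have := bleq N; lra.
pose P (xy : circle R * circle R) N :=
  val xy.1 < val xy.2 -> sep (G := circle_closed (p%:R / q%:R : R)) xy.1 xy.2 ->
  val xy.1 * N%:R + (b N)%:R <= val xy.2 * N%:R /\
  val xy.2 * N%:R + (b N)%:R <= val xy.1 * N%:R + N%:R.
have [[x y] _|M2 hM2] := @eventually_all _ (allpairs pair s s) P.
  case: (ltrP (val x) (val y)) => xy; last by exists 0%N => N _; rewrite /P /= ltNge xy.
  case xys : (sep (G := circle_closed (p%:R / q%:R : R)) x y); last first.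
    by exists 0%N => N _; rewrite /P /= xys.
  move: xys; rewrite circle_closed_sep // invf_div => /andP [h1 h2].
  have [|m1 hm1] := big (val y - val x - q%:R / p%:R); first by rewrite subr_gt0.
  have [|m2 hm2] := big (1 - (val y - val x) - q%:R / p%:R); first by rewrite subr_gt0.
  exists (maxn m1 m2) => N; rewrite geq_max => /andP [/hm1 e1 /hm2 e2] _ _.
  have := bleq N; rewrite [_.1]/= [_.2]/=; move: (b N)%:R => B; split; lra.
pose N := maxn 1 (maxn M1 M2).
have N0 : (0 < N)%N by rewrite leq_maxl.
exists N, (b N), (grid (b N) N0); split=> //.
  by rewrite (mulnC p); apply: ltn_ceil.
have bN : (2 * b N <= N)%N by apply: hM1; rewrite !leq_max leqnn !orbT.
have ok x y : x \in s -> y \in s -> val x < val y ->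
    sep (G := circle_closed (p%:R / q%:R : R)) x y -> sep (grid (b N) N0 x) (grid (b N) N0 y).
  move=> xs ys xy xys.
  have NM : (M2 <= N)%N by rewrite !leq_max leqnn !orbT.
  have xyss : (x, y) \in allpairs pair s s by apply/allpairsP; exists (x, y).
  by have [h1 h2] := hM2 N NM (x, y) xyss xy xys; apply: grid_sep.
move=> x y xs ys xys; case: (ltgtP (val x) (val y)) => [xy|yx|/val_inj xy].
- exact: ok.
- by rewrite sep_sym; apply: ok => //; rewrite sep_sym.
- by move: xys; rewrite xy /sep eqxx.
Qed.

(** One grid serves all coordinates of all the image points. *)
Lemma finite_le_circle_closed_pow (R : realType) (p q m : nat) (G : finGraph) :
  (0 < q)%N -> (2 * q < p)%N ->
  cohom_le G (strong_pow (circle_closed (p%:R / q%:R : R)) m) ->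
  exists a b, [/\ (0 < a)%N, (0 < b)%N, (a * q < p * b)%N
                 & cohom_le G (strong_pow (fraction_graph a b) m)].
Proof.
move=> q0 pq [f hf].
pose s := flatten [seq coords (f u) | u <- enum (fvertex G)].
have [a [b [g [a0 b0 ab hg]]]] := circle_closed_discretize s q0 pq.
exists a, b; split=> //.
exists (fun u => pow_map (g : circle_closed _ -> fraction_graph a b) (f u)).
have sub u : {subset coords (f u) <= s}.
  by move=> x xu; apply/flattenP; exists (coords (f u)) => //; apply: map_f; rewrite mem_enum.
apply: cohomP => u v /(cohom_sep hf); apply: pow_map_sep => x y /sub xs /sub ys.
exact: hg.
Qed.

(** * Sublinear sequences and points of the asymptotic spectrum *)

Definition sublinear (f : nat -> nat) : Prop :=
  forall j, exists M, forall n, (M <= n)%N -> (j * f n <= n)%N.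

Lemma sublinearP (R : realType) (f : nat -> nat) :
  (fun n => (f n)%:R : R) =o_\oo (fun n => n%:R : R) <-> sublinear f.
Proof.
split.
  move=> /eqoP h j; have [|M _ hM] := h (j.+1%:R^-1 : R); first by rewrite invr_gt0.
  exists M => n /hM /=; rewrite !ger0_norm // ler_pdivlMl // -natrM ler_nat.
  by apply: leq_trans; rewrite leq_mul2r leqnSn orbT.
move=> h; apply/eqoP => e e0.
have [M hM] := h (Num.bound (e^-1)); exists M => // n /hM /=.
rewrite !ger0_norm // -(ler_nat R) natrM => hn.
have : e^-1 * (f n)%:R <= n%:R.
  apply: le_trans hn; rewrite ler_wpM2r //; apply: ltW; apply: archi_boundP.
  by rewrite invr_ge0 ltW.
by rewrite mulrC ler_pdivrMr // mulrC.
Qed.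

Lemma littleo_sublinear (R : realType) (m : nat -> nat) :
  (fun n => (m n)%:R : R) = (fun n => n%:R : R) +o_\oo (fun n => n%:R : R) ->
  sublinear (fun n => m n - n)%N.
Proof.
move=> /eqaddoP h j; have [|M _ hM] := h (j.+1%:R^-1 : R); first by rewrite invr_gt0.
exists M => n /hM /=; rewrite ler_pdivlMl // (ger0_norm (ler0n _ n)) => hn.
have : j.+1%:R * ((m n)%:R - n%:R) <= n%:R :> R.
  by apply: le_trans hn; rewrite ler_wpM2l // ler_norm.
case: (leqP n (m n)) => nm; last by move=> _; rewrite (eqP (ltnW nm : _ - _ == 0)%N) muln0.
rewrite -natrB // -natrM ler_nat; apply: leq_trans.
by rewrite leq_mul2r leqnSn orbT.
Qed.

Lemma sublinear_littleo (R : realType) (f : nat -> nat) : sublinear f ->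
  (fun n => (n + f n)%N%:R : R) = (fun n => n%:R : R) +o_\oo (fun n => n%:R : R).
Proof.
move=> /(sublinearP R) /eqoP h; apply/eqaddoP => e /h; apply: filterS => n /=.
by rewrite -[X in _ -> `|X| <= _]/((n + f n)%N%:R - n%:R) natrD addrAC subrr add0r.
Qed.

Lemma ratio_lt (R : realType) (a b c d : nat) : (0 < b)%N -> (0 < d)%N ->
  (a%:R / b%:R < c%:R / d%:R :> R) = (a * d < c * b)%N.
Proof.
move=> b0 d0; rewrite ltr_pdivrMr ?ltr0n // mulrAC ltr_pdivlMr ?ltr0n //.
by rewrite -!natrM ltr_nat.
Qed.

Lemma ratio_le (R : realType) (a b c d : nat) : (0 < b)%N -> (0 < d)%N ->
  (a%:R / b%:R <= c%:R / d%:R :> R) = (a * d <= c * b)%N.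
Proof. by move=> b0 d0; rewrite leNgt ratio_lt // -leqNgt. Qed.

Section Spectrum.
Variables (R : realType) (F : finGraph -> R).
Hypothesis Fs : asym_spectrum F.

Lemma spectrum_le (G H : finGraph) : cohom_le G H -> F G <= F H.
Proof. by case: Fs => _ _ _ _; apply. Qed.

Lemma spectrum_exp (G : finGraph) n : F (fstrong_pow G n) = F G ^+ n.
Proof.
case: Fs => _ _ FM Fn _; elim: n => [|n IH]; first exact: (Fn 1%N).
by rewrite FM IH exprS.
Qed.

Lemma spectrum_ge1 (G : finGraph) (x : G) : 1 <= F G.
Proof.
have <- : F (edgeless 1) = 1 by case: Fs => _ _ _ Fn _; apply: (Fn 1%N).
exact: (spectrum_le (edgeless1_le x)).
Qed.

Lemma spectrum_le_card (G : finGraph) : F G <= #|fvertex G|%:R.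
Proof. by case: Fs => _ _ _ Fn _; rewrite -Fn; apply/spectrum_le/le_edgeless. Qed.

Lemma spectrum_fraction_ge1 a b : (0 < a)%N -> 1 <= F (fraction_graph a b).
Proof. by move=> a0; apply: (@spectrum_ge1 (fraction_graph a b) (Ordinal a0)). Qed.

Lemma spectrum_fraction_le_size a b : F (fraction_graph a b) <= a%:R.
Proof. by have := spectrum_le_card (fraction_graph a b); rewrite card_ord. Qed.

Lemma spectrum_pow_le (G H : finGraph) m n :
  cohom_le (strong_pow G m) (strong_pow H n) -> F G ^+ m <= F H ^+ n.
Proof.
rewrite -!fstrong_powE -!spectrum_exp; exact: spectrum_le.
Qed.

End Spectrum.

Lemma spec_dist_le (R : realType) (G H : finGraph) (e : R) : 0 <= e ->
  (forall F : finGraph -> R, asym_spectrum F -> `|F G - F H| <= e) ->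
  0 <= spec_dist R G H <= e.
Proof.
move=> e0 h; rewrite /spec_dist; set A := (X in sup X).
have [->|/set0P [x Ax]] := eqVneq A set0; first by rewrite sup0 lexx.
have ub : ubound A e by move=> _ [F Fs ->]; apply: h.
apply/andP; split; last by apply: ge_sup => //; exists x.
apply: (le_trans (y := x)); first by case: Ax => F _ ->.
by apply: ub_le_sup => //; exists e.
Qed.

Lemma le_spec_dist (R : realType) (G H : finGraph) (F : finGraph -> R) :
  asym_spectrum F -> `|F G - F H| <= spec_dist R G H.
Proof.
move=> Fs; apply: ub_le_sup; last by exists F.
exists (#|fvertex G|%:R + #|fvertex H|%:R) => _ [F' Fs' ->].
apply: le_trans (ler_normB _ _) _.
have F0 K : 0 <= F' K by case: Fs'.
by rewrite !ger0_norm //; apply: lerD; apply: spectrum_le_card.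
Qed.

Lemma bernoulli (R : realType) (t : R) k : 0 <= t <= 1 -> 1 - k%:R * t <= (1 - t) ^+ k.
Proof.
move=> /andP [t0 t1]; elim: k => [|k IH]; first by rewrite mul0r subr0.
rewrite exprS; apply: (le_trans (y := (1 - t) * (1 - k%:R * t))); last first.
  by rewrite ler_wpM2l // subr_ge0.
have : 0 <= k%:R * (t * t) by rewrite !mulr_ge0.
by rewrite -natr1; lra.
Qed.

(** If [y + eps <= x] then [x >= (1 + eps / M) y], so that
    [(1 + eps / M) ^ n <= y ^ (f n) <= M ^ (f n)]; this fails for a suitable [n]
    as [f] is sublinear, and [n] does not depend on [x] and [y]. *)
Lemma pow_sublinear (R : realType) (M eps : R) (f : nat -> nat) :
  1 <= M -> 0 < eps -> sublinear f ->
  exists n, forall x y : R, 1 <= y <= M -> x ^+ n <= y ^+ (n + f n) -> x < y + eps.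
Proof.
move=> M1 e0 subf; have M0 : 0 < M by exact: lt_le_trans M1.
pose g := 1 + eps / M.
have g1 : 1 < g by rewrite ltrDl divr_gt0.
have [j hj] : exists j, M < g ^+ j.
  have [j hj] : exists j : nat, M < 1 + j%:R * (eps / M).
    exists (Num.bound (M / (eps / M))).
    have := archi_boundP (_ : 0 <= M / (eps / M)).
    rewrite !divr_ge0 ?ltW // => /(_ isT); rewrite ltr_pdivrMr ?divr_gt0 // => h.
    by apply: lt_trans h _; rewrite ltrDr.
  exists j; apply: lt_le_trans hj _; elim: j => [|j IH]; first by rewrite mul0r addr0.
  rewrite exprS; apply: (le_trans (y := g * (1 + j%:R * (eps / M)))); last first.
    by rewrite ler_wpM2l // ltW // (lt_trans _ g1).
  have : 0 <= eps / M by rewrite divr_ge0 ?ltW.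
  rewrite /g -natr1; move: (eps / M) => t t0.
  have : 0 <= j%:R * (t * t) by rewrite !mulr_ge0.
  by lra.
have [N hN] := subf j; exists N.+1 => x y /andP [y1 yM] xy.
rewrite ltNge; apply/negP => yx.
have jf := hN N.+1 (leqnSn N); move: xy jf; set n := N.+1 => xy jf.
have y0 : 0 < y by exact: lt_le_trans y1.
have gy : g * y <= x.
  apply: le_trans yx; rewrite mulrDl mul1r lerD2l mulrAC ler_pdivrMr //.
  by rewrite ler_wpM2l // ltW.
have g0 : 0 <= g by rewrite ltW // (lt_trans _ g1).
have h1 : g ^+ n <= M ^+ f n.
  have gy0 : 0 <= g * y by rewrite mulr_ge0 ?(ltW y0).
  have : g ^+ n * y ^+ n <= y ^+ f n * y ^+ n.
    rewrite -exprMn -exprD (addnC (f n)); apply: le_trans xy.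
    by apply: lerXn2r => //; rewrite nnegrE // (le_trans gy0).
  rewrite ler_pM2r ?exprn_gt0 // => /le_trans; apply.
  by rewrite lerXn2r ?nnegrE ?(ltW y0) ?(ltW M0).
have h2 : (g ^+ n) ^+ j <= M ^+ n.
  apply: (le_trans (y := (M ^+ f n) ^+ j)).
    by rewrite lerXn2r ?nnegrE ?exprn_ge0 // ltW.
  by rewrite -exprM mulnC; apply: ler_weXn2l.
have : M ^+ n < (g ^+ j) ^+ n by rewrite ltrXn2r ?nnegrE ?exprn_ge0 // ltW.
by rewrite -!exprM mulnC ltNge exprM h2.
Qed.

(** * Implications between the conditions *)

Section Implications.
Variables (R : realType) (p q : nat).
Hypotheses (q0 : (0 < q)%N) (pq : (2 * q < p)%N).

Lemma asym_le_fraction (f : nat -> nat) :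
  (forall n, cohom_le (strong_pow (circle_open (p%:R / q%:R : R)) n)
                      (strong_pow (circle_closed (p%:R / q%:R : R)) (n + f n))) ->
  forall n, exists a b, [/\ (0 < a)%N, (0 < b)%N, (a * q < p * b)%N
    & cohom_le (strong_pow (fraction_graph p q) n) (strong_pow (fraction_graph a b) (n + f n))].
Proof.
move=> h n.
have [|a [b [a0 b0 ab le]]] :=
    @finite_le_circle_closed_pow R p q (n + f n) (fstrong_pow (fraction_graph p q) n) q0 pq.
  rewrite fstrong_powE; apply: cohom_le_trans (h n).
  exact: strong_pow_le (fraction_le_circle_open R p q0).
by exists a, b; split=> //; move: le; rewrite fstrong_powE.
Qed.

Lemma fraction_asym_le (f : nat -> nat) :
  (forall n, exists a b, [/\ (0 < a)%N, (0 < b)%N, (a * q < p * b)%N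
    & cohom_le (strong_pow (fraction_graph p q) n) (strong_pow (fraction_graph a b) (n + f n))]) ->
  forall n, cohom_le (strong_pow (circle_open (p%:R / q%:R : R)) n)
                     (strong_pow (circle_closed (p%:R / q%:R : R)) (n + f n)).
Proof.
move=> h n; have [a [b [a0 b0 ab le]]] := h n.
apply: cohom_le_trans (strong_pow_le n (circle_open_le_fraction R q0 (ltnW pq))) _.
apply: cohom_le_trans le _; apply: strong_pow_le.
by apply: fraction_le_circle_closed; rewrite ?ratio_lt.
Qed.

(** A single exponent [n] decides, and with it a single fraction [a / b]; every
    fraction between [a / b] and [p / q] inherits the estimate by monotonicity. *)
Lemma spectrum_uniform (f : nat -> nat) (eps : R) :
  sublinear f -> 0 < eps ->
  (forall n, exists a b, [/\ (0 < a)%N, (0 < b)%N, (a * q < p * b)%N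
    & cohom_le (strong_pow (fraction_graph p q) n) (strong_pow (fraction_graph a b) (n + f n))]) ->
  exists2 delta : R, 0 < delta &
    forall a b : nat, (0 < a)%N -> (0 < b)%N ->
      0 < (p%:R / q%:R - a%:R / b%:R : R) < delta ->
      forall F : finGraph -> R, asym_spectrum F ->
        F (fraction_graph p q) - F (fraction_graph a b) < eps.
Proof.
move=> subf e0 h; have p0 : (0 < p)%N by lia.
have p1 : 1 <= p%:R :> R by rewrite ler1n.
have [n hn] := pow_sublinear p1 e0 subf.
have [a [b [a0 b0 ab le]]] := h n.
exists (p%:R / q%:R - a%:R / b%:R); first by rewrite subr_gt0 ratio_lt.
move=> c d c0 d0 /andP [cpos clt] F Fs; rewrite ltrBlDl; apply: hn.
  rewrite spectrum_fraction_ge1 //=.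
  apply: le_trans (spectrum_fraction_le_size Fs p q); apply: spectrum_le => //.
  by apply: fraction_le => //; move: cpos; rewrite subr_gt0 ratio_lt // => /ltnW.
apply: spectrum_pow_le => //; apply: cohom_le_trans le _; apply: strong_pow_le.
apply: fraction_le => //; apply: ltnW; rewrite -(ratio_lt R) //.
by move: clt; rewrite ltrD2l ltrN2.
Qed.

(** Duality applies to the family of fraction graphs below [p / q] because these
    are totally ordered.  The family is restricted to ratios of at least [2] so
    that its members dominate the edgeless graph on two vertices; the remaining
    ones lie below [E_(2/1)] and do not change the supremum. *)
Lemma fraction_exponent (k : nat) : (0 < k)%N ->
  (forall F : finGraph -> R, asym_spectrum F ->
    sup [set x : R | exists a b : nat,
           [/\ (0 < a)%N, (0 < b)%N, a%:R / b%:R < p%:R / q%:R :> R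
             & x = F (fraction_graph a b)]] = F (fraction_graph p q)) ->
  exists a b c, [/\ (0 < a)%N, (0 < b)%N, (a * q < p * b)%N &
    forall N, cohom_le (strong_pow (fraction_graph p q) (k * N))
                       (strong_pow (fraction_graph a b) (k.+2 * N + c))].
Proof.
move=> k0 hsup; have p0 : (0 < p)%N by lia.
pose D G := exists a b,
  [/\ (0 < b)%N, (2 * b <= a)%N, (a * q < p * b)%N & G = fraction_graph a b].
have D2 : D (fraction_graph 2 1) by exists 2%N, 1%N; split=> //; lia.
have [||||_ [a [b [b0 ab lt ->]]] [c hc]] := @graph_duality R D (fraction_graph p q) k.
- by exists (fraction_graph 2 1).
- move=> _ _ [a [b [b0 ab lt ->]]] [c [d [d0 cd lt' ->]]].
  case: (leqP (a * d) (c * b)) => h.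
    exists (fraction_graph c d); split; [by exists c, d| |exact: cohom_le_refl].
    by apply: fraction_le => //; lia.
  exists (fraction_graph a b); split; [by exists a, b|exact: cohom_le_refl|].
  by apply: fraction_le => //; [lia|exact: ltnW].
- by move=> _ [a [b [b0 ab lt ->]]]; apply: edgeless2_le_fraction.
- move=> F Fs; set E := F (fraction_graph p q).
  have E1 : 1 <= E by exact: spectrum_fraction_ge1.
  have E0 : 0 < E by exact: lt_le_trans E1.
  (* With this t, the k-th power of 1 - t is at least 2/3, hence above 1/2. *)
  pose t : R := (3 * k)%:R^-1.
  have k3 : 0 < (3 * k)%:R :> R by rewrite ltr0n; lia.
  have t0 : 0 < t by rewrite invr_gt0.
  have t1 : t <= 1 by rewrite invf_le1 // ler1n; lia.
  have := hsup F Fs; rewrite -/E; set A := (X in sup X) => supE.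
  have supA : has_sup A.
    split; first by exists (F (fraction_graph 2 1)), 2%N, 1%N; split=> //; rewrite ratio_lt //; lia.
    exists E => _ [a [b [a0 b0 + ->]]]; rewrite ratio_lt // => lt.
    by apply: spectrum_le => //; apply: fraction_le => //; apply: ltnW.
  have [|_ [a [b [a0 b0 + ->]]]] := sup_adherent (eps := E * t) _ supA.
    by rewrite mulr_gt0.
  rewrite supE ratio_lt // => lt hE.
  have [G DG hG] : exists2 G, D G & E * (1 - t) <= F G.
    case: (leqP (2 * b) a) => ab.
      exists (fraction_graph a b); first by exists a, b.
      by rewrite mulrBr mulr1 ltW.
    exists (fraction_graph 2 1) => //; rewrite mulrBr mulr1.
    apply: le_trans (ltW hE) _; apply: spectrum_le => //; apply: fraction_le => //; lia.
  exists G => //.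
  have : (E * (1 - t)) ^+ k <= F G ^+ k.
    by rewrite lerXn2r ?nnegrE ?mulr_ge0 ?subr_ge0 ?(ltW E0) //; apply: le_trans hG;
      rewrite mulr_ge0 ?subr_ge0 ?(ltW E0).
  rewrite exprMn => hpow.
  have := bernoulli k (_ : 0 <= t <= 1); rewrite (ltW t0) t1 => /(_ isT).
  have -> : k%:R * t = 3^-1 by rewrite /t natrM invfM mulrCA divff ?mulr1 // pnatr_eq0; lia.
  have Ek : 0 < E ^+ k by rewrite exprn_gt0.
  move=> hb; have : E ^+ k * (1 - 3^-1) <= F G ^+ k.
    by apply: le_trans hpow; rewrite ler_pM2l.
  by lra.
by exists a, b, c; split=> //; lia.
Qed.

(** The bound with parameter [k = j + 1] is used with [N = n / k + 1], so that
    [n <= k N].  Its exponent exceeds [n] by about [2 n / k] plus a constant that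
    depends on [j], and the best [j] for each [n] makes the excess sublinear
    whatever these constants are. *)
Lemma diagonal_exponent (c : nat -> nat) : exists2 f : nat -> nat, sublinear f &
  forall n, exists j, (j.+3 * (n %/ j.+1).+1 + c j <= n + f n)%N.
Proof.
pose cost n j := (2 * (n %/ j.+1) + j.+3 + c j)%N.
exists (fun n => cost n [arg min_(j < ord0 : 'I_n.+1) cost n j]).
  (* With j = 4 J, the term 2 n / (j + 1) costs at most half of n / J. *)
  move=> J; pose j := (4 * J)%N; exists (j + 2 * J * (j.+3 + c j))%N => n hn.
  case: arg_minnP => // i _ min.
  have jn : (j < n.+1)%N by lia.
  have := min (Ordinal jn) isT; rewrite /cost /=.
  have := leq_trunc_div n j.+1.
  set d := (n %/ j.+1)%N; set e := (2 * (n %/ i.+1) + i.+3 + c i)%N => h1 h2.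
  apply: (@leq_trans (J * (2 * d + j.+3 + c j))); first by rewrite leq_mul2l h2 orbT.
  have {}h1 : (4 * (J * d) <= n)%N by apply: leq_trans h1; rewrite /j; lia.
  have {}hn : (2 * (J * (j.+3 + c j)) <= n)%N by lia.
  by lia.
move=> n; case: arg_minnP => // i _ _; exists i; rewrite /cost.
have := leq_trunc_div n i.+1; nia.
Qed.

Lemma sup_fraction_exponent :
  (forall F : finGraph -> R, asym_spectrum F ->
    sup [set x : R | exists a b : nat,
           [/\ (0 < a)%N, (0 < b)%N, a%:R / b%:R < p%:R / q%:R :> R
             & x = F (fraction_graph a b)]] = F (fraction_graph p q)) ->
  exists2 f : nat -> nat, sublinear f & forall n, exists a b,
    [/\ (0 < a)%N, (0 < b)%N, (a * q < p * b)%N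
    & cohom_le (strong_pow (fraction_graph p q) n) (strong_pow (fraction_graph a b) (n + f n))].
Proof.
move=> hsup; have p0 : (0 < p)%N by lia.
have /choice [c hc] : forall j, exists c, exists a b, [/\ (0 < a)%N, (0 < b)%N, (a * q < p * b)%N &
    forall N, cohom_le (strong_pow (fraction_graph p q) (j.+1 * N))
                       (strong_pow (fraction_graph a b) (j.+3 * N + c))].
  by move=> j; have [a [b [c h]]] := fraction_exponent (ltn0Sn j) hsup; exists c, a, b.
have [f subf hf] := diagonal_exponent c; exists f => // n.
have [j hj] := hf n; have [a [b [a0 b0 lt h]]] := hc j; exists a, b; split=> //.
apply: (cohom_le_trans _ (cohom_le_trans (h (n %/ j.+1).+1) _)).
  apply: (@strong_pow_leq (fraction_graph p q) (Ordinal p0)).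
  by rewrite mulnC; apply: ltnW; apply: ltn_ceil.
exact: (@strong_pow_leq (fraction_graph a b) (Ordinal a0)).
Qed.

End Implications.

Theorem theorem4p12 (R : realType) (p q : nat)
    (p_gt0 : (0 < p)%N) (q_gt0 : (0 < q)%N)
    (pq_gt2 : 2 < p%:R / q%:R :> R) :
  [<->
    (* (i) *)
    asym_equiv R (circle_closed (p%:R / q%:R : R))
                 (circle_open (p%:R / q%:R : R));
    (* (ii) *)
    exists m : nat -> nat,
      (fun n => (m n)%:R : R) = (fun n => n%:R : R) +o_\oo (fun n => n%:R : R)
      /\ forall n : nat, exists a b : nat,
           [/\ (0 < a)%N, (0 < b)%N, a%:R / b%:R < p%:R / q%:R :> R
             & cohom_le (strong_pow (fraction_graph p q) n)
                        (strong_pow (fraction_graph a b) (m n))];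
    (* (iii) *)
    forall eps : R, 0 < eps ->
      exists2 delta : R, 0 < delta &
        forall a b : nat, (0 < a)%N -> (0 < b)%N ->
          2 <= a%:R / b%:R :> R ->
          0 < (p%:R / q%:R - a%:R / b%:R : R) < delta ->
          forall F : finGraph -> R, asym_spectrum F ->
            F (fraction_graph p q) - F (fraction_graph a b) < eps;
    (* (iv) *)
    forall a b : nat -> nat,
      (forall n, (0 < a n)%N) -> (forall n, (0 < b n)%N) ->
      (forall n, (a n)%:R / (b n)%:R <= p%:R / q%:R :> R) ->
      ((a n)%:R / (b n)%:R : R) @[n --> \oo] --> (p%:R / q%:R : R) ->
      spec_cvg R (fun n => fraction_graph (a n) (b n)) (fraction_graph p q);
    (* (v) *)
    forall F : finGraph -> R, asym_spectrum F ->
      sup [set x : R | exists a b : nat,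
             [/\ (0 < a)%N, (0 < b)%N, a%:R / b%:R < p%:R / q%:R :> R
               & x = F (fraction_graph a b)]]
      = F (fraction_graph p q)].
Proof.
have pq : (2 * q < p)%N.
  by move: pq_gt2; rewrite ltr_pdivlMr ?ltr0n // -natrM ltr_nat.
tfae.
- move=> [_ [f [/sublinearP subf le]]]; exists (fun n => n + f n)%N.
  split; first exact: sublinear_littleo.
  move=> n; have [a [b [a0 b0 ab h]]] := asym_le_fraction q_gt0 pq le n.
  by exists a, b; rewrite ratio_lt.
- move=> [m [/littleo_sublinear subm le]] eps e0.
  have [|delta d0 h] := spectrum_uniform q_gt0 pq subm e0.
    move=> n; have [a [b [a0 b0 ab h]]] := le n.
    exists a, b; split=> //; first by rewrite -(ratio_lt R).
    apply: cohom_le_trans h _; apply: (@strong_pow_leq (fraction_graph a b) (Ordinal a0)).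
    by rewrite -leq_subLR.
  by exists delta => // a b a0 b0 _; apply: h.
- move=> h a b a0 b0 ab cvg; apply/cvgrPdist_le => eps e0.
  have [delta d0 hd] := h eps e0.
  have big : \forall n \near \oo, (p%:R / q%:R - (a n)%:R / (b n)%:R : R) < delta.
    move/cvgrPdist_lt: (cvg) => /(_ _ d0); apply: filterS => n.
    by apply: le_lt_trans; apply: ler_norm.
  have ge2 : \forall n \near \oo, 2 <= (a n)%:R / (b n)%:R :> R.
    move/cvgrPdist_lt: (cvg) => /(_ (p%:R / q%:R - 2)); rewrite subr_gt0 => /(_ pq_gt2).
    by apply: filterS => n; rewrite ltr_norml => /andP [_]; lra.
  near=> n; rewrite sub0r normrN.
  have /andP [s0 s1] : 0 <= spec_dist R (fraction_graph (a n) (b n)) (fraction_graph p q) <= eps.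
    apply: spec_dist_le; first exact: ltW.
    move=> F Fs; rewrite distrC.
    have := ab n; rewrite le_eqVlt => /orP [/eqP e|lt].
      have le1 : F (fraction_graph (a n) (b n)) <= F (fraction_graph p q).
        by apply: spectrum_le => //; apply: fraction_le => //; rewrite -(ratio_le R) // e.
      have le2 : F (fraction_graph p q) <= F (fraction_graph (a n) (b n)).
        by apply: spectrum_le => //; apply: fraction_le => //; rewrite -(ratio_le R) // e.
      by rewrite (@le_anti _ _ (F _) (F (fraction_graph p q))) ?le1 // subrr normr0 ltW.
    rewrite ger0_norm; last first.
      rewrite subr_ge0; apply: spectrum_le => //; apply: fraction_le => //.
      by rewrite -(ratio_le R).
    apply: ltW; apply: hd => //; first by near: n.
    by rewrite subr_gt0 lt; near: n.
  by rewrite ger0_norm.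
- move=> h F Fs.
  (* These fractions are p / q - 1 / (q (n + 1)). *)
  pose a n := (p * n.+1 - 1)%N; pose b n := (q * n.+1)%N.
  have a0 n : (0 < a n)%N by rewrite /a; nia.
  have b0 n : (0 < b n)%N by rewrite /b; nia.
  have lt n : (a n)%:R / (b n)%:R < p%:R / q%:R :> R by rewrite ratio_lt // /a /b; nia.
  have cvg : ((a n)%:R / (b n)%:R : R) @[n --> \oo] --> (p%:R / q%:R : R).
    have e n : (a n)%:R / (b n)%:R = p%:R / q%:R - q%:R^-1 * n.+1%:R^-1 :> R.
      rewrite /a /b natrB; last by nia.
      have qn0 : q%:R != 0 :> R by rewrite pnatr_eq0 -lt0n.
      have Nn0 : n.+1%:R != 0 :> R by rewrite pnatr_eq0.
      by rewrite !natrM; move: (n.+1%:R) Nn0 => N Nn0; field; rewrite Nn0.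
    rewrite (_ : (fun n => _) = (fun n => p%:R / q%:R - q%:R^-1 * harmonic n)); last exact/funext.
    rewrite -[X in _ --> X]subr0 -(mulr0 (q%:R^-1 : R)).
    apply: cvgB; first exact: cvg_cst.
    by apply: cvgMr; exact: cvg_harmonic.
  have := h a b a0 b0 (fun n => ltW (lt n)) cvg.
  set A := [set x | _].
  have ubA : ubound A (F (fraction_graph p q)).
    move=> _ [c [d [c0 d0 cd ->]]]; apply: spectrum_le => //; apply: fraction_le => //.
    by apply: ltnW; rewrite -(ratio_lt R).
  move=> /cvgrPdist_lt dist; apply: le_anti; apply/andP; split.
    by apply: ge_sup => //; exists (F (fraction_graph (a 0) (b 0))), (a 0), (b 0).
  apply/ler_addgt0Pr => eps e0; have [N _ hN] := dist _ e0.
  have := hN N (leqnn N); rewrite /= sub0r normrN => hN'.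
  have : F (fraction_graph (a N) (b N)) <= sup A.
    apply: ub_le_sup; first by exists (F (fraction_graph p q)).
    by exists (a N), (b N).
  have := le_spec_dist (fraction_graph (a N) (b N)) (fraction_graph p q) Fs.
  rewrite distrC => h1; have := ler_norm (F (fraction_graph p q) - F (fraction_graph (a N) (b N))).
  have := le_lt_trans (ler_norm _) hN'; lra.
- move=> hsup; have [f subf le] := sup_fraction_exponent q_gt0 pq hsup.
  split; last by exists f; split; [exact/sublinearP|exact: fraction_asym_le].
  exists (fun=> 0%N); split; first by apply/sublinearP => j; exists 0%N => n _; rewrite muln0.
  by move=> n; rewrite addn0; apply/strong_pow_le/circle_closed_le_open.
Unshelve. all: by end_near.
Qed.
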